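(* Let $n\ge 2$, let $U=B(O,1)$ be the open unit ball centered at the origin of $\mathbb{R}^n$, and let $M_0=U\times\mathbb{T}^n$ with its canonical symplectic form $\omega_0=\sum_{i=1}^n dx_i\wedge d\theta_i$. Generically, an Arnold--Liouville system admits no bi-Hamiltonian structure, in the following precise sense: the set $\mathcal{H}_{\rm BH}$ of those $H\in\mathcal{C}^\infty(U,\mathbb{R})$ for which the Arnold--Liouville system $(M_0,\omega_0,H)$ admits a bi-Hamiltonian structure (with recursion operator having the maximum number $n$ of eigenvalues) is a meagre subset of $\mathcal{C}^\infty(U,\mathbb{R})$ for the Fréchet topology.
   Context: Here $(x_1,\dots,x_n)$ are the (action) coordinates on $U$ and $(\theta_1,\dots,\theta_n)$ are the angle coordinates on the torus $\mathbb{T}^n$. For $H\in\mathcal{C}^\infty(U,\mathbb{R})$, the Arnold--Liouville system $(M_0,\omega_0,H)$ is the Hamiltonian system on $(M_0,\omega_0)$ whose Hamiltonian is $H$ regarded as a function on $M_0$ depending only on $(x_1,\dots,x_n)$; its Hamiltonian vector field $X_H$ is defined by $i_{X_H}\omega_0=-dH$. Given a second symplectic form $\omega_1$ on $M_0$, the associated recursion operator is the $(1,1)$-tensor field $J$ defined by $\omega_1(X,Y)=\omega_0(JX,Y)$ for all vector fields $X,Y$ on $M_0$. The forms $\omega_0,\omega_1$ are compatible if the Nijenhuis torsion of $J$ vanishes: $[JX,JY]-J[JX,Y]-J[X,JY]+J^2[X,Y]=0$ for all vector fields $X,Y$. The system $(M_0,\omega_0,H)$ is said to admit a bi-Hamiltonian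 structure if there exists a symplectic form $\omega_1$ on the whole of $M_0$ such that: (i) $\omega_1$ is compatible with $\omega_0$, and $X_H$ is at least locally Hamiltonian with respect to $\omega_1$, i.e. $d(i_{X_H}\omega_1)=0$ (equivalently $L_{X_H}\omega_1=0$); (ii) at each point $m\in M_0$ the endomorphism $J_m$ of $T_mM_0$ has the maximum possible number of distinct eigenvalues, namely $n$. The Fréchet topology on $\mathcal{C}^\infty(U,\mathbb{R})$ is the topology of uniform convergence of all partial derivatives of all orders on compact subsets of $U$. A subset of a metric space is meagre if it is contained in a countable union of closed subsets without interior points. *)

(* Defs.v *)
From HB Require Import structures.
From mathcomp Require Import all_boot all_order all_algebra.
From mathcomp Require Import all_classical all_reals all_analysis.

Set Implicit Arguments.
Unset Strict Implicit.
Unset Printing Implicit Defensive.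

Import Order.TTheory GRing.Theory Num.Theory.
Import numFieldNormedType.Exports.

Local Open Scope classical_set_scope.
Local Open Scope ring_scope.

Definition meagre (T : topologicalType) (A : set T) : Prop :=
  exists F : nat -> set T,
    (forall k, closed (F k) /\ (F k)^° = set0) /\ A `<=` \bigcup_k F k.

Section SmoothFunctions.
Variables (R : realType) (m : nat).
Implicit Types (V : normedModType R) (U : set 'rV[R]_m).

Definition partial V (i : 'I_m) (f : 'rV[R]_m -> V) : 'rV[R]_m -> V :=
  fun x => 'D_(delta_mx 0 i) f x.

Definition partials V (s : seq 'I_m) (f : 'rV[R]_m -> V) : 'rV[R]_m -> V :=
  foldr (@partial V) f s.

(* Meant for open U. The values of f outside U are irrelevant. *)
Definition smooth_on V U (f : 'rV[R]_m -> V) : Prop :=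
  forall (s : seq 'I_m) (x : 'rV[R]_m), U x -> differentiable (partials s f) x.

(* A smooth function on U is represented by its extension by 0 to R^m, so that
   Leibniz equality in Cinfty U is equality of functions on U. *)
Record Cinfty U := MkCinfty {
  cfun :> 'rV[R]_m -> R ;
  cfun_smooth : smooth_on U cfun ;
  cfun_out : forall x, ~ U x -> cfun x = 0 }.

HB.instance Definition _ U := gen_eqMixin (Cinfty U).
HB.instance Definition _ U := gen_choiceMixin (Cinfty U).

Definition jet U (f : Cinfty U) :
    prod_topology (fun _ : seq 'I_m => {family compactly_in U, 'rV[R]_m -> R}) :=
  fun s => partials s f.

(* The Fréchet topology: the coarsest one for which each f |-> partials s f is
   continuous into the space of functions with uniform convergence on the
   compact subsets of U. *)
HB.instance Definition _ U :=
  Topological.copy (Cinfty U) (initial_topology (@jet U)).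

End SmoothFunctions.

(* 'rV[R]_n carries the sup norm in the library, so its ball is not used. *)
Definition euclidean_unit_ball (R : realType) (n : nat) : set 'rV[R]_n :=
  [set x | \sum_(i < n) x 0 i ^+ 2 < 1].

Arguments euclidean_unit_ball : clear implicits.

(* Tensor fields on M0 = U x T^n, where T^n = R^n / (2 pi Z)^n, are given by
   their components in the global frame (d/dx_1, .., d/dx_n, d/dtheta_1, ..,
   d/dtheta_n), as functions of z = row_mx x theta on U x R^n that are
   2 pi-periodic in each theta_k.
   - a vector field, or a 1-form, has values in 'rV_(n + n);
   - a bilinear form W has values in 'M_(n + n), the value on u and v being
     u *m W *m v^T;
   - a (1,1)-tensor J has values in 'M_(n + n), and maps u to u *m J. *)
Section BiHamiltonian.
Variables (R : realType) (n : nat) (U : set 'rV[R]_n).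

Local Notation coords := 'rV[R]_(n + n).

Definition M0 : set coords := [set z | U (lsubmx z)].

Definition angle_periodic (V : Type) (f : coords -> V) : Prop :=
  forall (z : coords) (k : 'I_n), M0 z ->
    f (z + (2 * pi) *: delta_mx 0 (rshift n k)) = f z.

Definition smooth_M0 (V : normedModType R) (f : coords -> V) : Prop :=
  smooth_on M0 f /\ angle_periodic f.

Definition vector_field (X : coords -> 'rV[R]_(n + n)) : Prop := smooth_M0 X.

Definition form_eval (W : coords -> 'M[R]_(n + n)) (X Y : coords -> 'rV[R]_(n + n))
    (z : coords) : R :=
  (X z *m W z *m (Y z)^T) 0 0.

Definition interior_product (X : coords -> 'rV[R]_(n + n))
    (W : coords -> 'M[R]_(n + n)) (z : coords) : 'rV[R]_(n + n) :=
  X z *m W z.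

Definition apply_tensor (J : coords -> 'M[R]_(n + n))
    (X : coords -> 'rV[R]_(n + n)) (z : coords) : 'rV[R]_(n + n) :=
  X z *m J z.

Definition lie_bracket (X Y : coords -> 'rV[R]_(n + n)) (z : coords) :
    'rV[R]_(n + n) :=
  'D_(X z) Y z - 'D_(Y z) X z.

Definition ext_d0 (f : coords -> R) (z : coords) : 'rV[R]_(n + n) :=
  \row_i partial i f z.

Definition ext_d1 (a : coords -> 'rV[R]_(n + n)) (z : coords) :
    'M[R]_(n + n) :=
  \matrix_(i, j) (partial i (fun y => a y 0 j) z
                  - partial j (fun y => a y 0 i) z).

Definition ext_d2 (W : coords -> 'M[R]_(n + n)) (z : coords)
    (i j k : 'I_(n + n)) : R :=
  partial i (fun y => W y j k) z - partial j (fun y => W y i k) z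
  + partial k (fun y => W y i j) z.

Definition symplectic_form (W : coords -> 'M[R]_(n + n)) : Prop :=
  [/\ smooth_M0 W,
      forall z, M0 z -> (W z)^T = - W z,
      forall z, M0 z -> W z \in unitmx &
      forall z i j k, M0 z -> ext_d2 W z i j k = 0].

(* \sum_i dx_i /\ dtheta_i *)
Definition omega0 (z : coords) : 'M[R]_(n + n) :=
  block_mx 0 1%:M (- 1%:M) 0.

Definition hamiltonian_vector_field (H : 'rV[R]_n -> R)
    (X : coords -> 'rV[R]_(n + n)) : Prop :=
  vector_field X /\
  forall z, M0 z ->
    interior_product X omega0 z = - ext_d0 (fun y => H (lsubmx y)) z.

Definition recursion_operator (omega1 J : coords -> 'M[R]_(n + n)) : Prop :=
  smooth_M0 J /\
  forall X Y, vector_field X -> vector_field Y -> forall z, M0 z ->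
    form_eval omega1 X Y z = form_eval omega0 (apply_tensor J X) Y z.

Definition nijenhuis_torsion_free (J : coords -> 'M[R]_(n + n)) : Prop :=
  forall X Y, vector_field X -> vector_field Y -> forall z, M0 z ->
    lie_bracket (apply_tensor J X) (apply_tensor J Y) z
    - apply_tensor J (lie_bracket (apply_tensor J X) Y) z
    - apply_tensor J (lie_bracket X (apply_tensor J Y)) z
    + apply_tensor J (apply_tensor J (lie_bracket X Y)) z = 0.

(* J and XH are unique on M0, since omega0 is nondegenerate. *)
Definition admits_bihamiltonian (H : 'rV[R]_n -> R) : Prop :=
  exists omega1 J XH,
    [/\ symplectic_form omega1,
        recursion_operator omega1 J /\ nijenhuis_torsion_free J,
        hamiltonian_vector_field H XH,
        forall z, M0 z -> ext_d1 (interior_product XH omega1) z = 0 &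
        forall z, M0 z -> ([set a : R | eigenvalue (J z) a] #= `I_n)%card].

End BiHamiltonian.

(* Main.v *)
Require Import Defs.
From HB Require Import structures.
From mathcomp Require Import all_boot all_order all_algebra.
From mathcomp Require Import perm ring lra zify.
From mathcomp Require Import all_classical all_reals all_analysis.

Set Implicit Arguments.
Unset Strict Implicit.
Unset Printing Implicit Defensive.

Import Order.TTheory GRing.Theory Num.Theory.
Import numFieldNormedType.Exports.

Local Open Scope classical_set_scope.
Local Open Scope ring_scope.

(** Suppose that H admits a bi-Hamiltonian structure and that its Hessian S is
invertible at the origin, hence on a neighbourhood V.  Write omega_1 in blocks
A = (dx, dx), B = (dx, dtheta), C = (dtheta, dtheta).  On each torus X_H is the
constant field with frequencies grad H (x), and L_{X_H} omega_1 = 0 becomes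

    X_H C = 0,   X_H B = - S C,   X_H A = S B^T - B S.

A bounded function whose derivative along X_H is itself invariant would grow
linearly along the orbits unless this derivative vanishes ([flow_bounded]); so
C = 0 and B S is symmetric.  If X_H f = 0 over all of V, then differentiating
in x gives X_H (d_x f) = - S (d_theta f), whose right-hand side is invariant,
and the same argument gives d_theta f = 0 ([invariant_theta]).  Thus A and B
depend on x only, and K = B is a field of matrices on V (acting on row
vectors).  Closedness of omega_1, vanishing of the torsion, and symmetry of
B S combine into a single first-order system for F = (K | grad H):

    D_{uK} F = K D_u F   for every vector u       ([solution_field_eq]).

The matrix K(0) has n distinct eigenvalues, hence a cyclic vector v, which
remains cyclic near 0.  Every u is a combination of the v K^m, so the system
expresses all partial derivatives of F through the derivatives D_v^m F along
the single direction v.  Consequently the partial derivatives of order at most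
M of grad H at 0 are values of universal polynomials, independent of H, in v,
the inverse of the Krylov determinant, and the D_v^m F(0) with m <= M
([jet_poly_partials]).  The number p of these parameters is linear in M.

The k^2 numbers d_1^i d_2^j (d_1 H)(0) with i, j < k have order at most 2k, so
for large k they outnumber the parameters.  A Lipschitz image of a bounded
subset of R^p in R^q with p < q has a closure with empty interior
([lipschitz_image_nowhere_dense]).  Letting the parameters be bounded by
N = 0, 1, 2, ... covers the bi-Hamiltonian H with det S(0) <> 0 by countably
many closed sets; they have no interior because adding polynomials moves the
k^2 derivatives freely.  The H with det S(0) = 0 form one more such set. *)

(** * Symmetry of second derivatives *)

Section Lines.
Variables (R : realType) (V : normedModType R).
Implicit Types (f g : V -> R) (x y u v : V).

Lemma is_derive_line f y u (s : R) : derivable f (s *: u + y) u ->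
  is_derive s 1 (fun r : R => f (r *: u + y)) ('D_u f (s *: u + y)).
Proof.
move=> df.
have E : (fun h : R => h^-1 *: (((fun r : R => f (r *: u + y)) \o shift s) (h *: 1)
          - f (s *: u + y))) =
         (fun h : R => h^-1 *: ((f \o shift (s *: u + y)) (h *: u) - f (s *: u + y))).
  apply/funext => h /=; congr (_ *: (f _ - _)).
  by rewrite [h *: 1]mulr1 scalerDl addrA.
by split; rewrite /derivable /derive E.
Qed.

Lemma mean_value_line f y u (h : R) : 0 < h ->
  (forall s, 0 <= s <= h -> derivable f (s *: u + y) u) ->
  exists2 s, 0 <= s <= h & f (h *: u + y) - f y = 'D_u f (s *: u + y) * h.
Proof.
move=> h0 df.
have dl s : 0 <= s <= h ->
    is_derive s 1 (fun r : R => f (r *: u + y)) ('D_u f (s *: u + y)).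
  by move=> sh; apply: is_derive_line; exact: df.
have [||s] := @MVT R (fun r : R => f (r *: u + y))
    (fun s => 'D_u f (s *: u + y)) 0 h h0.
- by move=> s; rewrite in_itv/= => /andP[s0 sh]; apply: dl; rewrite !ltW.
- apply: derivable_within_continuous => s; rewrite in_itv/= => sh.
  by have [] := dl s sh.
rewrite in_itv/= => /andP[s0 sh]; rewrite subr0 scale0r add0r => E.
by exists s => //; rewrite !ltW.
Qed.

(** Two applications of the mean value theorem: first along u to the
increment of f by h v, then along v. *)
Lemma second_difference f x u v (h : R) : 0 < h ->
  (forall s t, 0 <= s <= h -> 0 <= t <= h ->
    differentiable f (t *: v + (s *: u + x)) /\
    differentiable ('D_u f) (t *: v + (s *: u + x))) ->
  exists s t, [/\ 0 <= s <= h, 0 <= t <= h &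
    f (h *: v + (h *: u + x)) - f (h *: u + x) - (f (h *: v + x) - f x) =
    'D_v ('D_u f) (t *: v + (s *: u + x)) * h * h].
Proof.
move=> h0 df.
have hh : 0 <= h <= h by rewrite lexx ltW.
have zh : 0 <= (0 : R) <= h by rewrite lexx ltW.
pose g y := f (h *: v + y) - f y.
have dg s : 0 <= s <= h -> is_derive (s *: u + x) u g
   ('D_u f (h *: v + (s *: u + x)) - 'D_u f (s *: u + x)).
  move=> sh.
  have d1 : differentiable f (h *: v + (s *: u + x)) by have [] := df s h sh hh.
  have d2 : differentiable f (s *: u + x).
    by have [+ _] := df s 0 sh zh; rewrite scale0r add0r.
  have d3 : is_derive (s *: u + x) u (fun y => f (h *: v + y))
     ('D_u f (h *: v + (s *: u + x))).
    have E (y : V) : (fun r : R => r^-1 *: (((fun y => f (h *: v + y)) \o shift y) (r *: u)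
          - f (h *: v + y))) =
         (fun r : R => r^-1 *: ((f \o shift (h *: v + y)) (r *: u) - f (h *: v + y))).
      by apply/funext => r /=; rewrite addrCA.
    split; rewrite /derivable /derive E //; exact: diff_derivable.
  have d4 : is_derive (s *: u + x) u f ('D_u f (s *: u + x)).
    by apply: derivableP; exact: diff_derivable.
  exact: is_deriveB.
have [s sh E1] : exists2 s, 0 <= s <= h & g (h *: u + x) - g x = 'D_u g (s *: u + x) * h.
  by apply: mean_value_line => // s sh; have [] := dg s sh.
have [t th E2] : exists2 t, 0 <= t <= h &
    'D_u f (h *: v + (s *: u + x)) - 'D_u f (s *: u + x) =
    'D_v ('D_u f) (t *: v + (s *: u + x)) * h.
  apply: (@mean_value_line ('D_u f)) => // t th; apply: diff_derivable.
  by have [] := df s t sh th.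
exists s, t; split => //; rewrite -E2.
by have [_ <-] := dg s sh; rewrite -E1 /g.
Qed.

Lemma dist_lt_double (a b z e : R) :
  `|a - z| < e -> `|b - z| < e -> `|a - b| < e + e.
Proof.
move=> az bz; have := ler_distD z a b; rewrite (distrC z b); move: az bz.
by move: `|_ - _| `|_ - _| `|_ - _| => p q r; lra.
Qed.

(** Both iterated derivatives at x are limits of the same second difference
of f over small parallelograms spanned by u and v. *)
Lemma derive_comm f x u v :
  (\forall y \near x, differentiable f y) ->
  (\forall y \near x, differentiable ('D_u f) y) ->
  (\forall y \near x, differentiable ('D_v f) y) ->
  {for x, continuous ('D_v ('D_u f))} -> {for x, continuous ('D_u ('D_v f))} ->
  'D_v ('D_u f) x = 'D_u ('D_v f) x.
Proof.
move=> d0 du dv cvu cuv.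
apply/eqP; rewrite -subr_eq0; apply/negPn/negP => ne0.
pose e := `|'D_v ('D_u f) x - 'D_u ('D_v f) x| / 3.
have e0 : 0 < e by rewrite divr_gt0 // normr_gt0.
have close_vu : \forall y \near x, `|'D_v ('D_u f) x - 'D_v ('D_u f) y| < e.
  by move/cvgrPdist_lt : cvu => /(_ e e0).
have close_uv : \forall y \near x, `|'D_u ('D_v f) x - 'D_u ('D_v f) y| < e.
  by move/cvgrPdist_lt : cuv => /(_ e e0).
have : nbhs x [set y | [/\ differentiable f y, differentiable ('D_u f) y,
  differentiable ('D_v f) y, `|'D_v ('D_u f) x - 'D_v ('D_u f) y| < e &
  `|'D_u ('D_v f) x - 'D_u ('D_v f) y| < e]].
  apply: filterS (filterI d0 (filterI du (filterI dv (filterI close_vu close_uv)))).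
  by move=> y [? [? [? [? ?]]]].
move=> /nbhs_ballP[r /= r0 near_x].
(* the parallelogram of side h fits in the ball of radius r; the + 1 covers
   the case u = v = 0 *)
pose h := r / (2 * (`|u| + `|v| + 1)).
have p0 : 0 < 2 * (`|u| + `|v| + 1).
  by rewrite mulr_gt0 // ltr_wpDl // addr_ge0.
have h0 : 0 < h by rewrite divr_gt0.
have in_ball s t : 0 <= s <= h -> 0 <= t <= h -> ball x r (t *: v + (s *: u + x)).
  move=> /andP[s0 sh] /andP[t0 th].
  rewrite -ball_normE /= addrA opprD addrCA subrr addr0 normrN.
  apply: (le_lt_trans (ler_normD _ _)); rewrite !normrZ !ger0_norm //.
  apply: (@le_lt_trans _ _ (h * (`|u| + `|v|))).
    rewrite mulrDr addrC; apply: lerD; exact: ler_wpM2r.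
  have -> : r = h * (2 * (`|u| + `|v| + 1)) by rewrite /h divfK // gt_eqF.
  rewrite ltr_pM2l //.
  have : 0 <= `|u| + `|v| by rewrite addr_ge0.
  by move: (`|u| + `|v|); clear; move=> p ?; lra.
have [s [t [sh th E1]]] : exists s t, [/\ 0 <= s <= h, 0 <= t <= h &
    f (h *: v + (h *: u + x)) - f (h *: u + x) - (f (h *: v + x) - f x) =
    'D_v ('D_u f) (t *: v + (s *: u + x)) * h * h].
  apply: second_difference => // s t sh th.
  by have [] := near_x _ (in_ball _ _ sh th).
have [s' [t' [sh' th' E2]]] : exists s t, [/\ 0 <= s <= h, 0 <= t <= h &
    f (h *: u + (h *: v + x)) - f (h *: v + x) - (f (h *: u + x) - f x) =
    'D_u ('D_v f) (t *: u + (s *: v + x)) * h * h].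
  apply: second_difference => // s' t' sh' th'.
  by rewrite addrCA; have [] := near_x _ (in_ball _ _ th' sh').
have E3 : 'D_v ('D_u f) (t *: v + (s *: u + x)) =
          'D_u ('D_v f) (t' *: u + (s' *: v + x)).
  apply: (mulIf (lt0r_neq0 h0)); apply: (mulIf (lt0r_neq0 h0)).
  refine (etrans (esym E1) (etrans _ E2)); rewrite (addrCA (h *: u)).
  by rewrite -!addrA; congr (_ + _); rewrite !opprD !opprK addrCA.
have [_ _ _ c1 _] := near_x _ (in_ball _ _ sh th).
have [_ _ _ _] := near_x _ (in_ball _ _ th' sh').
rewrite addrCA -E3 => c2.
have eE : `|'D_v ('D_u f) x - 'D_u ('D_v f) x| = e * 3 by rewrite /e divfK.
have := dist_lt_double c1 c2.
by rewrite eE; move: e0; clear; move: e => e; lra.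
Qed.

End Lines.

(** * Classes of functions stable under polynomial operations *)

(** The rows are v, v K, v K^2, ...: v is a cyclic vector of K exactly when
this matrix is invertible. *)
Definition krylov (R : realType) (p : nat) (v : 'rV[R]_p) (K : 'M[R]_p) : 'M[R]_p :=
  \matrix_(m < p) (v *m K ^+ m).

(** Functions take a parameter s besides the point x, and are compared on a
domain that depends on s, so that the same lemmas serve smooth functions of a
point, continuous functionals of H, and the class [jet_poly] below. *)
Section Closure.
Variables (R : realType) (S X : Type) (D : S -> X -> Prop).
Implicit Types phi psi : S -> X -> R.
Variable P : (S -> X -> R) -> Prop.
Hypothesis Pcst : forall c, P (fun _ _ => c).
Hypothesis Padd : forall phi psi, P phi -> P psi -> P (fun s x => phi s x + psi s x).
Hypothesis Pmul : forall phi psi, P phi -> P psi -> P (fun s x => phi s x * psi s x).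
Hypothesis Pext : forall phi psi, P phi ->
  (forall s x, D s x -> phi s x = psi s x) -> P psi.

Lemma closed_sum (I : Type) (r : seq I) (F : I -> S -> X -> R) :
  (forall i, P (F i)) -> P (fun s x => \sum_(i <- r) F i s x).
Proof.
move=> PF; elim: r => [|i r IH].
  by apply: Pext (Pcst 0) _ => s x _; rewrite big_nil.
by apply: Pext (Padd (PF i) IH) _ => s x _; rewrite big_cons.
Qed.

Lemma closed_prod (I : Type) (r : seq I) (F : I -> S -> X -> R) :
  (forall i, P (F i)) -> P (fun s x => \prod_(i <- r) F i s x).
Proof.
move=> PF; elim: r => [|i r IH].
  by apply: Pext (Pcst 1) _ => s x _; rewrite big_nil.
by apply: Pext (Pmul (PF i) IH) _ => s x _; rewrite big_cons.
Qed.

Lemma closed_det p (A : S -> X -> 'M[R]_p) :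
  (forall i j, P (fun s x => A s x i j)) -> P (fun s x => \det (A s x)).
Proof.
move=> PA; apply: closed_sum => sigma; apply: Pmul; first exact: Pcst.
by apply: closed_prod => i.
Qed.

Lemma closed_mulmx p q r (A : S -> X -> 'M[R]_(p, q))
    (B : S -> X -> 'M[R]_(q, r)) :
  (forall i j, P (fun s x => A s x i j)) -> (forall i j, P (fun s x => B s x i j)) ->
  forall i j, P (fun s x => (A s x *m B s x) i j).
Proof.
move=> PA PB i j; apply: (Pext (phi := fun s x => \sum_k A s x i k * B s x k j)).
  by apply: closed_sum => k; apply: Pmul.
by move=> s x _; rewrite mxE.
Qed.

Lemma closed_adj p (A : S -> X -> 'M[R]_p) :
  (forall i j, P (fun s x => A s x i j)) ->
  forall i j, P (fun s x => (\adj (A s x)) i j).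
Proof.
move=> PA i j; apply: (Pext (phi := fun s x => (-1) ^+ (j + i) *
   \det (row' j (col' i (A s x))))); last by move=> s x _; rewrite mxE.
apply: Pmul; first exact: Pcst.
apply: closed_det => k l; apply: Pext (PA (lift j k) (lift i l)) _ => s x _.
by rewrite !mxE.
Qed.

Lemma closed_exp p (K : S -> X -> 'M[R]_p) m :
  (forall i j, P (fun s x => K s x i j)) ->
  forall i j, P (fun s x => (K s x ^+ m) i j).
Proof.
move=> PK; elim: m => [|m IH] i j.
  by apply: Pext (Pcst ((i == j)%:R)) _ => s x _; rewrite expr0 mxE.
by apply: Pext (closed_mulmx PK IH i j) _ => s x _; rewrite exprS.
Qed.

Lemma closed_krylov p (v : S -> X -> 'rV[R]_p) (K : S -> X -> 'M[R]_p) :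
  (forall i j, P (fun s x => v s x i j)) -> (forall i j, P (fun s x => K s x i j)) ->
  forall i j, P (fun s x => krylov (v s x) (K s x) i j).
Proof.
move=> Pv PK i j; apply: Pext (closed_mulmx Pv (closed_exp i PK) 0 j) _ => s x _.
by rewrite [RHS]mxE.
Qed.

End Closure.

(** * Smooth functions on an open set *)

Section Smooth.
Variables (R : realType) (m : nat) (U : set 'rV[R]_m).
Hypothesis oU : open U.
Local Notation X := 'rV[R]_m.

Lemma near_eq_on (T : Type) (f g : X -> T) x :
  U x -> (forall y, U y -> f y = g y) -> \near x, f x = g x.
Proof. by move=> Ux fg; apply: filterS (open_nbhs_nbhs (conj oU Ux)) => y /fg. Qed.

(** A function equal to f near x has the same expansion at x, and the
differential is characterized by that expansion. *)
Lemma near_eq_differentiable (V W : normedModType R) (f g : V -> W) (x : V) :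
  (\near x, f x = g x) -> differentiable f x -> differentiable g x.
Proof.
move=> fg /diff_locallyP[cf /eqaddoP ef].
have eg : g \o shift x = cst (g x) + 'd f x +o_ 0 id.
  apply/eqaddoP => e e0; have := ef e e0; rewrite -(nbhs_singleton fg) => efe.
  have fg0 : \forall h \near 0, f (h + x) = g (h + x).
    by move: fg; rewrite (near_shift 0); apply: filterS => h /=; rewrite subr0.
  by apply: filterS2 fg0 efe => h gh; rewrite !fctE /= gh.
have dg : 'd g x = 'd f x :> (V -> W) by apply: diff_unique.
by apply/diff_locallyP; rewrite dg.
Qed.

Lemma smooth_subset (V : normedModType R) (D : set X) (f : X -> V) :
  D `<=` U -> smooth_on U f -> smooth_on D f.
Proof. by move=> DU sf s x /DU; apply: sf. Qed.

Lemma partials_rcons (V : normedModType R) s i (f : X -> V) :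
  partials (rcons s i) f = partials s (partial i f).
Proof. by rewrite /partials foldr_rcons. Qed.

Lemma derive_partial (V : normedModType R) (f : X -> V) x v :
  differentiable f x -> 'D_v f x = \sum_i v 0 i *: partial i f x.
Proof.
move=> df; rewrite deriveE // {1}(row_sum_delta v) linear_sum.
by apply: eq_bigr => i _; rewrite linearZ /= /partial deriveE.
Qed.

Lemma eq_partials (V : normedModType R) (f g : X -> V) s x :
  (forall y, U y -> f y = g y) -> U x -> partials s f x = partials s g x.
Proof.
move=> fg; elim: s x => [|i s IH] x Ux /=; first exact: fg.
by apply: near_eq_derive; apply: near_eq_on.
Qed.

Lemma smooth_ext (V : normedModType R) (f g : X -> V) :
  (forall y, U y -> f y = g y) -> smooth_on U f -> smooth_on U g.
Proof.
move=> fg sf s x Ux; apply: near_eq_differentiable (sf s x Ux).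
by apply: near_eq_on => // y Uy; apply: eq_partials.
Qed.

Lemma smooth_differentiable (V : normedModType R) (f : X -> V) x :
  smooth_on U f -> U x -> differentiable f x.
Proof. by move=> sf; apply: (sf [::]). Qed.

Lemma smooth_partial (V : normedModType R) (f : X -> V) i :
  smooth_on U f -> smooth_on U (partial i f).
Proof. by move=> sf s x Ux; rewrite -partials_rcons; apply: sf. Qed.

(** Smoothness is the largest property of differentiable functions that is
stable under partial derivatives; this spares an induction on multi-indices in
the closure lemmas below. *)
Lemma smooth_coind (V : normedModType R) (P : (X -> V) -> Prop) :
  (forall f, P f -> (forall x, U x -> differentiable f x) /\
     forall i, exists2 g, P g & forall x, U x -> partial i f x = g x) ->
  forall f, P f -> smooth_on U f.
Proof.
move=> HP f Pf s; elim/last_ind: s f Pf => [|s i IH] f Pf x Ux.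
  exact: (HP f Pf).1.
have [g Pg fg] := (HP f Pf).2 i.
rewrite partials_rcons; apply: near_eq_differentiable (IH g Pg x Ux).
by apply: near_eq_on => // y Uy; apply: eq_partials => // z Uz; rewrite fg.
Qed.

Lemma smooth_cst (V : normedModType R) (c : V) : smooth_on U (fun=> c).
Proof.
apply: (@smooth_coind _ (fun f => exists c, f = fun=> c)); last by exists c.
move=> _ [a ->]; split=> [x _|i]; first exact: differentiable_cst.
by exists (fun=> 0); [exists 0|move=> x _; rewrite /partial derive_cst].
Qed.

Lemma smooth_add (V : normedModType R) (f g : X -> V) :
  smooth_on U f -> smooth_on U g -> smooth_on U (fun x => f x + g x).
Proof.
move=> sf sg; apply: (@smooth_coind _ (fun h => exists f g,
  [/\ smooth_on U f, smooth_on U g & h = fun x => f x + g x])); last by exists f, g.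
move=> _ {sf sg f g} [f [g [sf sg ->]]].
have df x (Ux : U x) := smooth_differentiable sf Ux.
have dg x (Ux : U x) := smooth_differentiable sg Ux.
split=> [x Ux|i]; first exact: differentiableD (df x Ux) (dg x Ux).
exists (fun x => partial i f x + partial i g x).
  by exists (partial i f), (partial i g); split => //; apply: smooth_partial.
move=> x Ux; rewrite /partial -deriveD //; apply: diff_derivable; by [apply: df|apply: dg].
Qed.

Lemma partials_add (V : normedModType R) (f g : X -> V) s x :
  smooth_on U f -> smooth_on U g -> U x ->
  partials s (fun x => f x + g x) x = partials s f x + partials s g x.
Proof.
move=> sf sg; elim: s x => [//|i s IH] x Ux /=.
rewrite {1}/partial (@near_eq_derive _ _ _ _ (partials s f + partials s g)).
  by rewrite deriveD //; apply: diff_derivable; by [apply: sf|apply: sg].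
by apply: near_eq_on.
Qed.

Lemma smooth_sum (V : normedModType R) (I : Type) (r : seq I) (F : I -> X -> V) :
  (forall i, smooth_on U (F i)) -> smooth_on U (fun x => \sum_(i <- r) F i x).
Proof.
move=> sF; elim: r => [|i r IH].
  by apply: smooth_ext (smooth_cst 0) => y _; rewrite big_nil.
by apply: smooth_ext (smooth_add (sF i) IH) => y _; rewrite big_cons.
Qed.

Lemma partials_cst0 (V : normedModType R) s : partials s (fun _ : X => 0 : V) = (fun=> 0).
Proof.
elim: s => //= i s ->; apply/funext => x.
by rewrite /partial derive_cst.
Qed.

Lemma partials_sum (V : normedModType R) (I : Type) (r : seq I) (F : I -> X -> V) s x :
  (forall i, smooth_on U (F i)) -> U x ->
  partials s (fun x => \sum_(i <- r) F i x) x = \sum_(i <- r) partials s (F i) x.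
Proof.
move=> sF Ux; elim: r => [|i r IH].
  rewrite big_nil (_ : (fun _ => _) = fun=> 0) ?partials_cst0 //.
  by apply/funext => y; rewrite big_nil.
rewrite big_cons -IH -partials_add //; last exact: smooth_sum.
by apply: eq_partials => // y _; rewrite big_cons.
Qed.

(** The smallest class containing the products of smooth functions and
stable under the Leibniz rule, so that it can be fed to [smooth_coind]. *)
Inductive sum_of_products : (X -> R) -> Prop :=
| SumOfProductsMul (f g : X -> R) : smooth_on U f -> smooth_on U g ->
    sum_of_products (fun x => f x * g x)
| SumOfProductsAdd (f g : X -> R) : sum_of_products f -> sum_of_products g ->
    sum_of_products (fun x => f x + g x).

Lemma smooth_mul (f g : X -> R) :
  smooth_on U f -> smooth_on U g -> smooth_on U (fun x => f x * g x).
Proof.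
move=> sf sg; apply: (@smooth_coind _ sum_of_products); last exact: SumOfProductsMul.
clear f g sf sg.
move=> h; elim=> {h} [f g sf sg|f g Pf [df IHf] Pg [dg IHg]].
  have df x (Ux : U x) := smooth_differentiable sf Ux.
  have dg x (Ux : U x) := smooth_differentiable sg Ux.
  split=> [x Ux|i]; first exact: differentiableM (df x Ux) (dg x Ux).
  exists (fun x => f x * partial i g x + g x * partial i f x).
    by apply: SumOfProductsAdd; apply: SumOfProductsMul => //; apply: smooth_partial.
  move=> x Ux; rewrite /partial deriveM //; apply: diff_derivable; by [apply: df|apply: dg].
split=> [x Ux|i]; first exact: differentiableD (df x Ux) (dg x Ux).
have [f' Pf' ff'] := IHf i; have [g' Pg' gg'] := IHg i.
exists (fun x => f' x + g' x); first exact: SumOfProductsAdd.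
move=> x Ux; rewrite -ff' // -gg' // /partial -deriveD //; apply: diff_derivable.
  exact: df.
exact: dg.
Qed.

Lemma smooth_scale c (f : X -> R) :
  smooth_on U f -> smooth_on U (fun x => c * f x).
Proof. exact/smooth_mul/smooth_cst. Qed.

Lemma partials_scale c (f : X -> R) s x : smooth_on U f -> U x ->
  partials s (fun x => c * f x) x = c * partials s f x.
Proof.
move=> sf; elim: s x => [//|i s IH] x Ux /=.
rewrite {1}/partial (@near_eq_derive _ _ _ _ (c *: partials s f)).
  by rewrite deriveZ //; apply: diff_derivable; apply: sf.
by apply: near_eq_on.
Qed.

Lemma partial_sum_mul (I : finType) (f g : I -> X -> R) i x :
  (forall k, smooth_on U (f k)) -> (forall k, smooth_on U (g k)) -> U x ->
  partial i (fun y => \sum_k f k y * g k y) x =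
  \sum_k partial i (f k) x * g k x + \sum_k f k x * partial i (g k) x.
Proof.
move=> sf sg Ux.
have -> : partial i (fun y => \sum_k f k y * g k y) x =
    \sum_k partial i (fun y => f k y * g k y) x.
  by apply: (partials_sum _ [:: i]) => // k; apply: smooth_mul.
rewrite -big_split /=; apply: eq_bigr => k _; rewrite [LHS]deriveM.
- by rewrite addrC; congr (_ + _); rewrite mulrC.
- by apply: diff_derivable; apply: smooth_differentiable (sf k) Ux.
- by apply: diff_derivable; apply: smooth_differentiable (sg k) Ux.
Qed.

Lemma smooth_coord j : smooth_on U (fun x : X => x 0 j).
Proof.
apply: (@smooth_coind _ (fun f => f = (fun x => x 0 j) \/ exists c, f = fun=> c)); last by left.
move=> _ [->|[c ->]]; split=> [x _|i].
- exact: differentiable_coord.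
- pose e : X := delta_mx 0 i.
  exists (fun=> e 0 j); first by right; exists (e 0 j).
  move=> x _; rewrite /partial.
  have := @derive_mx R _ 1 m id x (delta_mx 0 i) (@derivable_id _ _ _ _).
  by rewrite derive_id => /matrixP /(_ 0 j); rewrite [in RHS]mxE => ->.
- exact: differentiable_cst.
- by exists (fun=> 0); [right; exists 0|move=> x _; rewrite /partial derive_cst].
Qed.

Lemma smooth_derive (f : X -> R) v : smooth_on U f -> smooth_on U ('D_v f).
Proof.
move=> sf; apply: (@smooth_ext _ (fun x => \sum_i v 0 i * partial i f x)).
  by move=> y Uy; rewrite derive_partial //; apply: smooth_differentiable.
by apply: smooth_sum => i; apply/smooth_scale/smooth_partial.
Qed.

Lemma smooth_derive_comm (f : X -> R) u v x : smooth_on U f -> U x ->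
  'D_v ('D_u f) x = 'D_u ('D_v f) x.
Proof.
move=> sf Ux.
have nd g : smooth_on U g -> \forall y \near x, differentiable g y.
  move=> sg; apply: filterS (open_nbhs_nbhs (conj oU Ux)) => y Uy.
  exact: smooth_differentiable.
apply: derive_comm.
- exact: nd.
- exact/nd/smooth_derive.
- exact/nd/smooth_derive.
- apply: differentiable_continuous; apply: (smooth_differentiable _ Ux).
  by do 2!apply: smooth_derive.
- apply: differentiable_continuous; apply: (smooth_differentiable _ Ux).
  by do 2!apply: smooth_derive.
Qed.

Lemma smooth_det p (A : X -> 'M[R]_p) :
  (forall i j, smooth_on U (fun x => A x i j)) -> smooth_on U (fun x => \det (A x)).
Proof.
exact: (closed_det (P := fun f : unit -> X -> R => smooth_on U (f tt))
  (D := fun _ x => U x) (fun c => smooth_cst c) (fun _ _ => @smooth_add _ _ _)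
  (fun _ _ => @smooth_mul _ _) (fun _ _ sf e => smooth_ext (e tt) sf)
  (A := fun _ => A)).
Qed.

Lemma smooth_krylov p v (K : X -> 'M[R]_p) :
  (forall i j, smooth_on U (fun x => K x i j)) ->
  forall i j, smooth_on U (fun x => krylov v (K x) i j).
Proof.
apply: (closed_krylov (P := fun f : unit -> X -> R => smooth_on U (f tt))
  (D := fun _ x => U x) (fun c => smooth_cst c) (fun _ _ => @smooth_add _ _ _)
  (fun _ _ => @smooth_mul _ _) (fun _ _ sf e => smooth_ext (e tt) sf)
  (K := fun _ => K) (v := fun _ _ => v)) => i j; exact: smooth_cst.
Qed.

Section Entries.
Variables (p q : nat) (W : X -> 'M[R]_(p, q)).
Hypothesis sW : smooth_on U W.

Lemma partials_entry s x i j : U x ->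
  partials s (fun y => W y i j) x = partials s W x i j.
Proof.
elim: s x => [//|k s IH] x Ux /=.
rewrite {1}/partial (@near_eq_derive _ _ _ _ (fun y => partials s W y i j)).
  rewrite [in RHS]/partial derive_mx ?mxE //.
  by apply: diff_derivable; apply: sW.
by apply: near_eq_on.
Qed.

Lemma smooth_entry i j : smooth_on U (fun y => W y i j).
Proof.
move=> s x Ux; apply: (@near_eq_differentiable _ _ (fun y => partials s W y i j)).
  by apply: near_eq_on => // y Uy; rewrite partials_entry.
apply: (@differentiable_comp _ _ _ _ (partials s W) (fun M : 'M[R]_(p, q) => M i j)).
  exact: sW.
exact: differentiable_coord.
Qed.
End Entries.

End Smooth.

(** * Universal polynomials for jets *)

Section Solutions.
Variables (R : realType) (n : nat).
Local Notation X := 'rV[R]_n.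

(** A germ at 0 of a solution F = (K | g) of D_{uK} F = K D_u F, together
with a constant direction that stays cyclic for K; the block g (one column) will
be the gradient of H. *)
Record solution := Solution {
  dom : set X;
  fld : X -> 'M[R]_(n, n + 1);
  dir : X;
  dom_open : open dom;
  dom0 : dom 0;
  fld_smooth : forall a b, smooth_on dom (fun x => fld x a b);
  dir_cyclic : forall x, dom x -> \det (krylov dir (lsubmx (fld x))) != 0;
  fld_eq : forall x u a b, dom x ->
    'D_(u *m lsubmx (fld x)) (fun y => fld y a b) x =
    \sum_c lsubmx (fld x) a c * 'D_u (fun y => fld y c b) x }.

Implicit Types (s : solution) (phi psi : solution -> X -> R).

Definition op s x : 'M[R]_n := lsubmx (fld s x).
Definition kappa s x := (\det (krylov (dir s) (op s x)))^-1.
Definition along s (f : X -> R) : X -> R := 'D_(dir s) f.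
Definition vjet s m a b : X -> R := iter m (along s) (fun x => fld s x a b).

Lemma vjet_smooth s m a b : smooth_on (dom s) (vjet s m a b).
Proof.
elim: m => [|m IH]; first exact: fld_smooth.
by apply: smooth_derive => //; exact: dom_open.
Qed.

(** Functions of a solution and a point that are given by one polynomial,
the same for all solutions, in the direction, the inverse Krylov determinant
[kappa], and the derivatives of order at most M of the field along the direction. *)
Inductive jet_poly (M : nat) : (solution -> X -> R) -> Prop :=
| JPcst c : jet_poly M (fun _ _ => c)
| JPdir i : jet_poly M (fun s _ => dir s 0 i)
| JPkappa : jet_poly M kappa
| JPjet m a b : (m <= M)%N -> jet_poly M (fun s => vjet s m a b)
| JPadd phi psi : jet_poly M phi -> jet_poly M psi ->
    jet_poly M (fun s x => phi s x + psi s x)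
| JPmul phi psi : jet_poly M phi -> jet_poly M psi ->
    jet_poly M (fun s x => phi s x * psi s x)
| JPext phi psi : jet_poly M phi ->
    (forall s x, dom s x -> phi s x = psi s x) -> jet_poly M psi.

Lemma jet_poly_fld M a b : jet_poly M (fun s x => fld s x a b).
Proof. exact: (@JPjet M 0). Qed.

Lemma jet_poly_op M a b : jet_poly M (fun s x => op s x a b).
Proof. by apply: JPext (jet_poly_fld M a (lshift 1 b)) _ => s x _; rewrite [RHS]mxE. Qed.

Lemma jet_poly_mono M M' phi : (M <= M')%N -> jet_poly M phi -> jet_poly M' phi.
Proof.
move=> leM; elim=> {phi}.
- exact: JPcst.
- exact: JPdir.
- exact: JPkappa.
- by move=> m a b mM; apply/JPjet/(leq_trans mM).
- by move=> phi psi _ + _; apply: JPadd.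
- by move=> phi psi _ + _; apply: JPmul.
- by move=> phi psi _ + e; move/JPext; apply.
Qed.

(** These are the entries of the inverse Krylov matrix. *)
Lemma jet_poly_inverse M i j :
  jet_poly M (fun s x => kappa s x * (\adj (krylov (dir s) (op s x))) i j).
Proof.
apply: JPmul; first exact: JPkappa.
have [[[c a] m] e] := (JPcst M, JPadd (M := M), JPmul (M := M), JPext (M := M)).
apply: (closed_adj c a m e) => i' j'.
apply: (closed_krylov c a m e (v := fun s _ => dir s)); last exact: jet_poly_op.
by move=> k l; rewrite (ord1 k); exact: JPdir.
Qed.

Lemma near_dom s x (T : Type) (f g : X -> T) :
  dom s x -> (forall y, dom s y -> f y = g y) -> \near x, f x = g x.
Proof. by move=> sx; apply: near_eq_on => //; exact: dom_open. Qed.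

Section Derivation.
Variables (M : nat) (u : solution -> X).
Hypothesis du_jet : forall m a b, (m <= M)%N ->
  jet_poly M.+1 (fun s x => 'D_(u s) (vjet s m a b) x).

Let derives phi := [/\ jet_poly M phi,
  forall s x, dom s x -> differentiable (phi s) x &
  jet_poly M.+1 (fun s x => 'D_(u s) (phi s) x)].

Let derives_cst c : derives (fun _ _ => c).
Proof.
split; [exact: JPcst|by move=> s x _; exact: differentiable_cst|].
by apply: JPext (JPcst _ 0) _ => s x _; rewrite derive_cst.
Qed.

Let derives_add phi psi : derives phi -> derives psi ->
  derives (fun s x => phi s x + psi s x).
Proof.
move=> [P1 D1 Q1] [P2 D2 Q2]; split; first exact: JPadd.
  by move=> s x sx; exact: differentiableD (D1 s x sx) (D2 s x sx).
apply: JPext (JPadd Q1 Q2) _ => s x sx.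
by rewrite -deriveD //; apply: diff_derivable; [apply: D1|apply: D2].
Qed.

Let derives_mul phi psi : derives phi -> derives psi ->
  derives (fun s x => phi s x * psi s x).
Proof.
move=> [P1 D1 Q1] [P2 D2 Q2]; split; first exact: JPmul.
  by move=> s x sx; exact: differentiableM (D1 s x sx) (D2 s x sx).
have lM := leqnSn M.
apply: JPext (JPadd (JPmul (jet_poly_mono lM P1) Q2) (JPmul (jet_poly_mono lM P2) Q1)) _.
move=> s x sx; rewrite deriveM //; apply: diff_derivable; [exact: D1|exact: D2].
Qed.

Let derives_ext phi psi : derives phi ->
  (forall s x, dom s x -> phi s x = psi s x) -> derives psi.
Proof.
move=> [P1 D1 Q1] e; split; first exact: JPext e.
  move=> s x sx; apply: near_eq_differentiable (D1 s x sx).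
  by apply: near_dom sx _ => y; apply: e.
apply: JPext Q1 _ => s x sx; apply: near_eq_derive.
by apply: near_dom sx _ => y; apply: e.
Qed.

Let derives_dir i : derives (fun s _ => dir s 0 i).
Proof.
split; [exact: JPdir|by move=> s x _; exact: differentiable_cst|].
by apply: JPext (JPcst _ 0) _ => s x _; rewrite derive_cst.
Qed.

Let derives_jet m a b : (m <= M)%N -> derives (fun s => vjet s m a b).
Proof.
move=> mM; split; [exact: JPjet| |exact: du_jet].
move=> s x sx; apply: smooth_differentiable sx; exact: vjet_smooth.
Qed.

Let derives_kappa : derives kappa.
Proof.
have [P1 D1 Q1] : derives (fun s x => \det (krylov (dir s) (op s x))).
  apply: (closed_det derives_cst derives_add derives_mul derives_ext) => i j.
  apply: (closed_krylov derives_cst derives_add derives_mul derives_ext (v := fun s _ => dir s)).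
    by move=> k l; rewrite (ord1 k).
  move=> k l; apply: derives_ext (@derives_jet 0 k (lshift 1 l) isT) _ => s x _.
  by rewrite [RHS]mxE.
have ne s x : dom s x -> \det (krylov (dir s) (op s x)) != 0 by exact: dir_cyclic.
split; first exact: JPkappa.
  move=> s x sx; exact: differentiableV (D1 s x sx) (ne s x sx).
have K2 := JPmul (JPcst M.+1 (-1)) (JPmul (JPkappa M.+1) (JPkappa M.+1)).
apply: JPext (JPmul K2 Q1) _ => s x sx.
rewrite [RHS](deriveV (f := fun y => \det (krylov (dir s) (op s y)))).
- by rewrite /kappa mulN1r expr2 invfM scaleNr mulNr.
- exact: ne.
- by apply: diff_derivable; apply: D1.
Qed.

(** Only the behaviour of a derivation on the variables [vjet] has to be
known: on [kappa] it is dictated by the Leibniz rule for the inverse of the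
Krylov determinant, which is itself a polynomial in the other variables. *)
Lemma jet_poly_derives phi : jet_poly M phi -> derives phi.
Proof.
elim=> {phi} //.
- by move=> phi psi _ + _; apply: derives_add.
- by move=> phi psi _ + _; apply: derives_mul.
- by move=> phi psi _ + e; move/derives_ext; apply.
Qed.
End Derivation.

Lemma jet_poly_dir M phi : jet_poly M phi ->
  jet_poly M.+1 (fun s x => 'D_(dir s) (phi s) x).
Proof.
move=> P; have [] // := @jet_poly_derives M (fun s => dir s) _ phi P.
by move=> m a b mM; apply: (@JPjet _ m.+1).
Qed.

Lemma jet_poly_iter_dir M phi m : jet_poly M phi ->
  jet_poly (m + M) (fun s => iter m (along s) (phi s)).
Proof. by move=> P; elim: m => [//|m IH]; apply: jet_poly_dir. Qed.

(** Iterating D_{uK} F = K D_u F along u = v, v K, v K^2, ... *)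
Lemma fld_eq_exp s x v m a b : dom s x ->
  'D_(v *m op s x ^+ m) (fun y => fld s y a b) x =
  \sum_c (op s x ^+ m) a c * 'D_v (fun y => fld s y c b) x.
Proof.
move=> sx; elim: m v a => [|m IH] v a.
  rewrite expr0 mulmx1 (bigD1 a) //= big1 ?addr0 ?mxE ?eqxx ?mul1r // => c /negPf ca.
  by rewrite mxE eq_sym ca mul0r.
rewrite exprSr mulmxA [LHS]fld_eq //.
under eq_bigr => c _ do rewrite IH mulr_sumr.
rewrite exchange_big /=; apply: eq_bigr => d _.
rewrite -exprSr exprS mxE mulr_suml.
by apply: eq_bigr => c _; rewrite mulrA.
Qed.

(** The inverse Krylov matrix writes each basis vector as a combination of
the v K^m, and the derivative along v K^m is K^m times the derivative along v. *)
Lemma jet_poly_partial_fld i a b :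
  jet_poly 1 (fun s x => partial i (fun y => fld s y a b) x).
Proof.
pose G m s x := \sum_c (op s x ^+ m) a c * vjet s 1 c b x.
have [[[c0 a0] m0] e0] := (JPcst 1, JPadd (M := 1), JPmul (M := 1), JPext (M := 1)).
have PG m : jet_poly 1 (G m).
  apply: (closed_sum c0 a0 e0) => c; apply: JPmul; last exact: (@JPjet 1 1 c b).
  by apply: (closed_exp c0 a0 m0 e0); apply: jet_poly_op.
have P1 : jet_poly 1 (fun s x => \sum_(m < n)
   (kappa s x * (\adj (krylov (dir s) (op s x))) i m) * G m s x).
  by apply: (closed_sum c0 a0 e0) => m; apply: JPmul (PG m); apply: jet_poly_inverse.
apply: JPext P1 _ => s x sx; rewrite /partial.
have Ei : delta_mx 0 i = \sum_(m < n) (kappa s x *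
    (\adj (krylov (dir s) (op s x))) i m) *: (dir s *m op s x ^+ m).
  have : (kappa s x *: \adj (krylov (dir s) (op s x))) *m krylov (dir s) (op s x) = 1%:M.
    by rewrite -scalemxAl mul_adj_mx scale_scalar_mx mulVf // dir_cyclic.
  move/(congr1 (row i)); rewrite row1 => <-.
  rewrite row_mul mulmx_sum_row; apply: eq_bigr => m _.
  by rewrite !mxE rowK.
rewrite Ei deriveE; last first.
  by apply: smooth_differentiable sx; exact: fld_smooth.
rewrite linear_sum; apply: eq_bigr => m _; rewrite linearZ /= -deriveE; last first.
  by apply: smooth_differentiable sx; exact: fld_smooth.
by rewrite fld_eq_exp.
Qed.

Lemma partial_iter_dir s m i f x : smooth_on (dom s) f -> dom s x ->
  partial i (iter m (along s) f) x = iter m (along s) (partial i f) x.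
Proof.
have oD := @dom_open s.
move=> sf; elim: m x => [//|m IH] x sx /=.
rewrite /partial (smooth_derive_comm oD) //; last first.
  by elim: m {IH} => //= m IH; exact: smooth_derive.
by apply: near_eq_derive; apply: near_dom sx _ => y sy; rewrite -IH.
Qed.

(** Partial derivatives commute with the derivative along the direction, so
[jet_poly_partial_fld] also gives the partial derivatives of every [vjet]. *)
Lemma jet_poly_partial M phi i : jet_poly M phi ->
  jet_poly M.+1 (fun s x => partial i (phi s) x).
Proof.
move=> P; have [] // := @jet_poly_derives M (fun s => delta_mx 0 i) _ phi P.
move=> m a b mM; apply: (@jet_poly_mono (m + 1)); first by rewrite addn1.
apply: JPext (jet_poly_iter_dir m (jet_poly_partial_fld i a b)) _ => s x sx.
by rewrite -partial_iter_dir //; apply: fld_smooth.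
Qed.

(** All partial derivatives of a solution are universal polynomials in its
derivatives along the cyclic direction alone. *)
Lemma jet_poly_partials l a b :
  jet_poly (size l) (fun s x => partials l (fun y => fld s y a b) x).
Proof.
elim: l => [|i l IH] /=; first exact: jet_poly_fld.
exact: jet_poly_partial.
Qed.

Section Lipschitz.
Variable M : nat.

Definition parameter : finType :=
  ('I_n + option ('I_M.+1 * ('I_n * 'I_(n + 1))))%type.

Definition par (k : parameter) s : R :=
  match k with
  | inl i => dir s 0 i
  | inr None => kappa s 0
  | inr (Some (m, (a, b))) => vjet s m a b 0
  end.

Lemma card_parameter : #|{: parameter}| = (n + (M.+1 * (n * (n + 1))).+1)%N.
Proof. by rewrite card_sum card_option !card_prod !card_ord. Qed.

(** A polynomial is bounded and Lipschitz on bounded sets, with the same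
constants for all solutions. *)
Lemma jet_poly_lipschitz phi (N : R) : jet_poly M phi -> exists2 L, 0 <= L &
  forall s t d, (forall k, `|par k s| <= N) -> (forall k, `|par k t| <= N) ->
    (forall k, `|par k s - par k t| <= d) ->
    `|phi s 0| <= L /\ `|phi s 0 - phi t 0| <= L * d.
Proof.
have base phi' k : (forall s, phi' s 0 = par k s) -> exists2 L, 0 <= L &
  forall s t d, (forall k, `|par k s| <= N) -> (forall k, `|par k t| <= N) ->
    (forall k, `|par k s - par k t| <= d) ->
    `|phi' s 0| <= L /\ `|phi' s 0 - phi' t 0| <= L * d.
  move=> E; exists (`|N| + 1); first by rewrite addr_ge0.
  move=> s t d Ns Nt st; rewrite !E; split.
    by apply: (le_trans (Ns k)); apply: (le_trans (ler_norm N)); rewrite lerDl.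
  apply: (le_trans (st k)); rewrite ler_peMl //; last by rewrite lerDr.
  exact: le_trans (st k).
elim=> {phi}.
- move=> c; exists `|c| => // s t d _ _ st; rewrite subrr normr0; split=> //.
  by rewrite mulr_ge0 //; apply: le_trans (st (inr None)).
- by move=> i; apply: (base (fun s _ => dir s 0 i) (inl i)).
- exact: (base kappa (inr None)).
- move=> m a b mM.
  by apply: (base (fun s => vjet s m a b) (inr (Some (Ordinal (mM : m < M.+1)%N, (a, b))))).
- move=> phi psi _ [L1 L10 H1] _ [L2 L20 H2]; exists (L1 + L2).
    by rewrite addr_ge0.
  move=> s t d Ns Nt st.
  have [B1 D1] := H1 s t d Ns Nt st; have [B2 D2] := H2 s t d Ns Nt st.
  split; first by apply: (le_trans (ler_normD _ _)); apply: lerD.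
  rewrite opprD addrACA mulrDl; apply: (le_trans (ler_normD _ _)).
  exact: lerD.
- move=> phi psi _ [L1 L10 H1] _ [L2 L20 H2].
  exists (L1 * L2 + (L1 * L2 + L1 * L2)); first by rewrite !addr_ge0 ?mulr_ge0.
  move=> s t d Ns Nt st.
  have [B1 D1] := H1 s t d Ns Nt st; have [B2 D2] := H2 s t d Ns Nt st.
  have tt0 k : `|par k t - par k t| <= 0 by rewrite subrr normr0.
  have [B3 _] := H2 t t 0 Nt Nt tt0.
  have d0 : 0 <= d by apply: le_trans (st (inr None)).
  have LL : 0 <= L1 * L2 by rewrite mulr_ge0.
  split.
    rewrite normrM; apply: (@le_trans _ _ (L1 * L2)); first exact: ler_pM.
    by rewrite lerDl addr_ge0.
  have -> : phi s 0 * psi s 0 - phi t 0 * psi t 0 =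
    phi s 0 * (psi s 0 - psi t 0) + (phi s 0 - phi t 0) * psi t 0.
    by rewrite mulrBr mulrBl addrA subrK.
  apply: (le_trans (ler_normD _ _)); rewrite !normrM.
  apply: (@le_trans _ _ (L1 * (L2 * d) + (L1 * d) * L2)).
    by apply: lerD; apply: ler_pM.
  rewrite mulrAC mulrA -mulrDl; apply: ler_wpM2r => //.
  by rewrite lerDr.
- move=> phi psi _ [L L0 H] e; exists L => // s t d Ns Nt st.
  by have := H s t d Ns Nt st; rewrite !e //; apply: dom0.
Qed.

End Lipschitz.
End Solutions.

(** * Lipschitz images of bounded sets *)

Section Pigeonhole.
Variable R : realType.

(** Since q > p, the power m^q outgrows (C m)^p whatever the factor C is. *)
Lemma pigeonhole_grid (p q C : nat) : (p < q)%N ->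
  exists m, (0 < m)%N /\ ((C * m) ^ p < m ^ q)%N.
Proof.
move=> pq; exists (C ^ p).+1; split => //; set m := (C ^ p).+1.
apply: (@leq_trans (m ^ p.+1)); last by rewrite leq_pexp2l.
by rewrite expnMn expnS ltn_pmul2r ?expn_gt0.
Qed.

Lemma same_cell (A w y z : R) : 0 < w -> 0 <= y + A -> 0 <= z + A ->
  Num.truncn ((y + A) / w) = Num.truncn ((z + A) / w) -> `|y - z| <= w.
Proof.
move=> w0 y0 z0 E.
have cell u : 0 <= u + A ->
    (Num.truncn ((u + A) / w))%:R * w <= u + A < (Num.truncn ((u + A) / w)).+1%:R * w.
  move=> u0; rewrite -ler_pdivlMr // -ltr_pdivrMr //; apply: truncn_itv.
  by rewrite divr_ge0 // ltW.
move: (cell y y0) (cell z z0); rewrite -E; move: (Num.truncn _) => k.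
rewrite -natr1 mulrDl mul1r => /andP[y1 y2] /andP[z1 z2].
rewrite ler_norml; move: (k%:R * w) y1 y2 z1 z2 => u y1 y2 z1 z2.
by apply/andP; split; lra.
Qed.

(** Cut the parameter box into (C m)^#|I| cells and the cube of radius
delta into m^#|Q| grid points.  If every grid point were approached by the
image, then two of them would be approached from the same cell, against the
Lipschitz bound, as soon as C is large and m exceeds C^#|I|. *)
Lemma lipschitz_image_nowhere_dense (T : Type) (I Q : finType)
    (a : T -> I -> R) (j : T -> Q -> R) (N L : R) :
  (#|I| < #|Q|)%N -> 0 <= L ->
  (forall x i, `|a x i| <= N) ->
  (forall x y d, (forall i, `|a x i - a y i| <= d) ->
    forall q, `|j x q - j y q| <= L * d) ->
  forall (c : Q -> R) (delta : R), 0 < delta ->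
  exists2 t : Q -> R, (forall q, `|t q - c q| <= delta) &
  exists2 e : R, 0 < e & forall x, exists q, e < `|j x q - t q|.
Proof.
move=> IQ L0 aN jL c delta d0; apply: contrapT => dense.
have approx (t : Q -> R) e : (forall q, `|t q - c q| <= delta) -> 0 < e ->
    exists x, forall q, `|j x q - t q| <= e.
  move=> tc e0; apply: contrapT => nox; apply: dense; exists t => //; exists e => // x.
  apply: contrapT => noq; apply: nox; exists x => q.
  by rewrite leNgt; apply/negP => qe; apply: noq; exists q.
pose A := `|N| + 1.
have A0 : 0 < A by rewrite ltr_wpDl.
have NA : N < A by rewrite /A; apply: (le_lt_trans (ler_norm N)); rewrite ltrDl.
(* C > 4 L A / delta makes the variation L w inside a cell, of width
   w = 2 A / (C m), less than half the grid step delta / m; the two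
   approximation errors delta / (4 m) account for the other half. *)
pose C := (Num.truncn (4 * L * A / delta)).+1.
have C0 : 0 < C%:R :> R by rewrite ltr0n.
have CL : 4 * L * A < C%:R * delta.
  by rewrite -ltr_pdivrMr //; apply: truncnS_gt.
have [m [m0 mlt]] := pigeonhole_grid C IQ.
have m0' : 0 < m%:R :> R by rewrite ltr0n.
pose w := 2 * A / (C * m)%:R.
have w0 : 0 < w by rewrite divr_gt0 ?mulr_gt0 // ltr0n muln_gt0 m0.
pose t (f : {ffun Q -> 'I_m}) (q : Q) := c q + delta * (f q)%:R / m%:R.
have tc f q : `|t f q - c q| <= delta.
  rewrite /t addrAC subrr add0r ger0_norm; last first.
    by rewrite divr_ge0 ?mulr_ge0 // ltW.
  rewrite ler_pdivrMr // ler_pM2l // ler_nat; exact: ltnW.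
have e0 : 0 < delta / (4 * m%:R) by rewrite divr_gt0 ?mulr_gt0.
have /choice[x xt] : forall f, exists x, forall q, `|j x q - t f q| <= delta / (4 * m%:R).
  by move=> f; apply: approx.
have aA y i : 0 <= a y i + A.
  have := aN y i; rewrite ler_norml => /andP[Na _].
  by rewrite -lerBlDr sub0r; apply: le_trans Na; rewrite lerN2 ltW.
have cellP y i : (Num.truncn ((a y i + A) / w) < C * m)%N.
  rewrite truncn_lt_nat; last by rewrite divr_ge0 // ltW.
  rewrite ltr_pdivrMr // /w mulrCA mulfV ?mulr1; last first.
    by rewrite pnatr_eq0 -lt0n muln_gt0 m0.
  rewrite mulrC mulr_natr mulr2n ltrD2r.
  by apply: le_lt_trans NA; apply: le_trans (aN y i); exact: ler_norm.
pose cell f : {ffun I -> 'I_(C * m)} := [ffun i => Ordinal (cellP (x f) i)].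
have cell_inj : injective cell.
  move=> f g /ffunP fg; apply/ffunP => q; apply/val_inj/eqP/negPn/negP => nfg.
  have ad i : `|a (x f) i - a (x g) i| <= w.
    apply: same_cell (aA _ _) (aA _ _) _ => //.
    by have := fg i; rewrite !ffunE => /(congr1 val).
  have jd := jL _ _ _ ad q.
  have tfg : delta / m%:R <= `|t f q - t g q|.
    have -> : t f q - t g q = delta / m%:R * ((f q)%:R - (g q)%:R).
      by rewrite /t; move: m0' => /gt_eqF/negbT m1; field.
    rewrite normrM gtr0_norm ?divr_gt0 // ler_peMr ?(ltW (divr_gt0 d0 m0')) //.
    have -> : (f q)%:R - (g q)%:R = ((f q)%:Z - (g q)%:Z)%:~R :> R.
      by rewrite rmorphB.
    rewrite -intr_norm ler1z -gtz0_ge1 normr_gt0 subr_eq0.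
    by apply: contra nfg => /eqP [E]; apply/eqP.
  have xf := xt f q; have xg := xt g q.
  have : `|t f q - t g q| <= L * w + (delta / (4 * m%:R) + delta / (4 * m%:R)).
    have -> : t f q - t g q = (j (x f) q - j (x g) q) +
      (- (j (x f) q - t f q) + (j (x g) q - t g q)).
      by move: (t f q) (t g q) (j _ _) (j _ _); clear=> *; ring.
    apply: (le_trans (ler_normD _ _)); apply: lerD => //.
    by apply: (le_trans (ler_normD _ _)); rewrite normrN; apply: lerD.
  move/(le_trans tfg); apply/negP; rewrite -ltNge.
  rewrite -(ltr_pM2l (_ : 0 < C%:R * m%:R :> R)) ?mulr_gt0 //.
  have -> : C%:R * m%:R * (delta / m%:R) = C%:R * delta.
    by move: m0' => /gt_eqF/negbT m1; field.
  have -> : C%:R * m%:R * (L * w + (delta / (4 * m%:R) + delta / (4 * m%:R))) =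
     2 * L * A + C%:R * delta / 2.
    rewrite /w natrM; move: m0' C0 => /gt_eqF/negbT m1 /gt_eqF/negbT C1.
    by field; rewrite m1 C1.
  move: CL; clear; move: (C%:R * delta) => z.
  by rewrite -!mulrA; move: (L * A) => y; lra.
have := leq_card cell cell_inj.
by rewrite !card_ffun !card_ord leqNgt mlt.
Qed.

End Pigeonhole.

(** * The Fréchet topology *)

Section Frechet.
Variables (R : realType) (m : nat) (U : set 'rV[R]_m).
Hypothesis oU : open U.
Local Notation X := 'rV[R]_m.

Lemma smooth_function_extension (f : X -> R) : smooth_on U f ->
  exists F : Cinfty U, forall x, U x -> F x = f x.
Proof.
move=> sf; pose g x := if `[< U x >] then f x else 0.
have gf x : U x -> g x = f x by move=> Ux; rewrite /g asboolT.
have sg : smooth_on U g.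
  by apply: (smooth_ext oU _ sf) => x Ux; rewrite gf.
have g0 x : ~ U x -> g x = 0 by move=> nUx; rewrite /g asboolF.
by exists (MkCinfty sg g0).
Qed.

(** Evaluation of a fixed partial derivative, uniformly on a compact set, is
continuous for the Fréchet topology. *)
Lemma nbhs_jet (H : Cinfty U) (s : seq 'I_m) (A : set X) (e : R) :
  A `<=` U -> compact A -> 0 < e ->
  nbhs H [set H' : Cinfty U | forall x, A x -> `|partials s H x - partials s H' x| < e].
Proof.
move=> AU cA e0.
have cjet : continuous (@jet R m U) by exact: initial_continuous.
pose Y := {family compactly_in U, X -> R}.
pose E : set (R * R) := [set xy | `|xy.1 - xy.2| < e].
have entE : entourage E.
  rewrite -entourage_ballE; exists e => //.
have nE : nbhs (partials s H : Y) [set g : Y | forall y, A y -> E (partials s H y, g y)].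
  exact: fam_nbhs.
have cs : continuous (fun h : prod_topology (fun _ : seq 'I_m => Y) => h s).
  exact: (@proj_continuous _ (fun _ : seq 'I_m => Y) s).
exact: (cjet H _ (cs (jet H) _ nE)).
Qed.

Lemma compact_partials_bounded (f : X -> R) s (A : set X) :
  smooth_on U f -> A `<=` U -> compact A ->
  exists2 B, 0 <= B & forall x, A x -> `|partials s f x| <= B.
Proof.
move=> sf AU cA.
have [->|/set0P A0] := eqVneq A set0; first by exists 0.
have cf : {within A, continuous (fun x => `|partials s f x|)}.
  apply: continuous_in_subspaceT => x; rewrite inE => /AU Ux.
  apply: continuous_comp; last exact: norm_continuous.
  by apply: differentiable_continuous; apply: sf.
have [c _ cmax] := compact_EVT_max A0 cA cf.
by exists `|partials s f c| => // x Ax; apply: cmax; rewrite inE.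
Qed.

Section Perturbation.
Variables (I : finType) (q : I -> X -> R).
Hypothesis sq : forall i, smooth_on U (q i).

Let box := filter_from [set e : R | 0 < e] (fun e => [set c : I -> R | forall i, `|c i| <= e]).

Let box_filter : Filter box.
Proof.
apply: filter_from_filter; first by exists 1 => /=.
move=> e f /= e0 f0; exists (Num.min e f); first by rewrite /= lt_min e0.
by move=> c ch; split=> i; have := ch i; rewrite le_min => /andP[].
Qed.

(** Adding small combinations of finitely many smooth functions stays in
any prescribed neighbourhood, since each partial derivative of these functions
is bounded on compact sets. *)
Lemma perturbation (H : Cinfty U) : exists P : (I -> R) -> Cinfty U,
  (forall c s x, U x ->
    partials s (P c) x = partials s H x + \sum_i c i * partials s (q i) x) /\
  forall W, nbhs H W -> exists2 e, 0 < e & forall c, (forall i, `|c i| <= e) -> W (P c).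
Proof.
have spert c : smooth_on U (fun x => H x + \sum_i c i * q i x).
  apply: smooth_add => //; first exact: cfun_smooth.
  by apply: smooth_sum => // i; apply: smooth_scale.
have /choice[P PE] : forall c, exists F : Cinfty U,
    forall x, U x -> F x = H x + \sum_i c i * q i x.
  by move=> c; apply: smooth_function_extension.
have partials_P c s x : U x ->
    partials s (P c) x = partials s H x + \sum_i c i * partials s (q i) x.
  move=> Ux.
  have sc i : smooth_on U (fun x => c i * q i x) by apply: smooth_scale.
  rewrite (eq_partials oU _ (PE c) Ux).
  rewrite (partials_add oU _ (@cfun_smooth _ _ _ H) (smooth_sum oU _ sc) Ux).
  rewrite (partials_sum oU _ _ sc Ux); congr (_ + _).
  by apply: eq_bigr => i _; rewrite (partials_scale oU).
exists P; split => // W nW.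
suff : P @ box --> H by move=> /(_ W nW)[e e0 eW]; exists e => // c ce; apply: eW.
move=> {nW W} W [V0 [[B oB <-]]] /= BH /filterS; apply; first exact: fmap_filter.
suff : (@jet R m U \o P) @ box --> (jet H : prod_topology (fun _ => {family compactly_in U, X -> R})).
  by move=> cv; exact: (cv B (open_nbhs_nbhs (conj oB BH))).
have FF : Filter ((@jet R m U \o P) @ box) by exact: fmap_filter.
apply/cvg_sup => s {oB BH B V0} W' [V0 [[B oB <-]]] /= BH /filterS; apply.
suff : (fun c => partials s (P c)) @ box --> (partials s H : {family compactly_in U, X -> R}).
  by move=> cv; exact: (cv B (open_nbhs_nbhs (conj oB BH))).
have Fs : Filter ((fun c => partials s (P c)) @ box) by exact: fmap_filter.
apply/fam_cvgP => {oB BH B V0 W W'} A [AU cA] V /uniform_nbhs[E [+ EV]].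
rewrite -entourage_ballE => -[e /= e0 eE].
have /choice[B BA] : forall i, exists b, 0 <= b /\ forall x, A x -> `|partials s (q i) x| <= b.
  by move=> i; have [b b0 bP] := compact_partials_bounded s (sq i) AU cA; exists b.
have B0 : 0 <= \sum_i B i by apply: sumr_ge0 => i _; case: (BA i).
exists (e / (1 + \sum_i B i) / 2) => /=.
  by rewrite !divr_gt0 // ltr_wpDr.
move=> c ce; apply: EV => x Ax; apply: eE; rewrite /= /ball /=.
rewrite (partials_P _ _ _ (AU _ Ax)).
rewrite opprD addrA subrr sub0r normrN.
apply: (@le_lt_trans _ _ (e / (1 + \sum_i B i) / 2 * \sum_i B i)).
  apply: (le_trans (ler_norm_sum _ _ _)); rewrite mulr_sumr; apply: ler_sum => i _.
  by rewrite normrM; apply: ler_pM => //; case: (BA i) => _; apply.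
move: B0; move: (\sum_i B i) => b b0.
rewrite -!mulrA gtr_pMr // ltr_pdivrMl; last by rewrite ltr_wpDr.
by rewrite mulr1; lra.
Qed.

End Perturbation.
End Frechet.

(** * Test functions *)

Section Monomials.
Variables (R : realType) (n : nat).
Local Notation X := 'rV[R]_n.

Definition divided_power (i : 'I_n) (k : nat) (x : X) : R := x 0 i ^+ k / k`!%:R.

Lemma smooth_divided_power (U : set X) i k : open U -> smooth_on U (divided_power i k).
Proof.
move=> oU; have sX : smooth_on U (fun x : X => x 0 i ^+ k).
  elim: k => [|k IH]; first exact: (smooth_cst oU).
  apply: (smooth_ext oU) (smooth_mul oU (smooth_coord oU i) IH) => x _.
  by rewrite exprS.
by apply: (smooth_mul oU sX); exact: (smooth_cst oU).
Qed.

Lemma partial_coord (i j : 'I_n) x : partial j (fun x : X => x 0 i) x = (i == j)%:R.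
Proof.
rewrite /partial; have := @derive_mx R _ 1 n id x (delta_mx 0 j) (@derivable_id _ _ _ _).
by rewrite derive_id => /matrixP /(_ 0 i); rewrite !mxE eqxx => <-.
Qed.

Lemma partial_divided_power i j k x :
  partial j (divided_power i k) x = (i == j)%:R * (if k is k'.+1 then divided_power i k' x else 0).
Proof.
have dc : is_derive x (delta_mx 0 j) (fun x : X => x 0 i) (i == j)%:R.
  rewrite -(partial_coord i j x); apply: derivableP; apply: diff_derivable.
  exact: differentiable_coord.
case: k => [|k].
  rewrite mulr0 /partial (_ : divided_power i 0 = fun=> 1) ?derive_cst //.
  by apply/funext => y; rewrite /divided_power expr0 fact0 divr1.
have dX := @is_deriveX R _ (fun x : X => x 0 i) k.+1 x (delta_mx 0 j) _ dc.
have -> : divided_power i k.+1 = (k.+1`!%:R^-1 : R) *: ((fun x : X => x 0 i) ^+ k.+1).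
  by apply/funext => y; rewrite /divided_power mulrC fctE.
rewrite [LHS]deriveZ; last by case: dX.
rewrite (@derive_val _ _ _ _ _ _ _ dX) /divided_power.
rewrite /= factS natrM ![_ *: _]/(_ * _).
have k0 : k.+1%:R != 0 :> R by rewrite pnatr_eq0.
have f0 : k`!%:R != 0 :> R by rewrite pnatr_eq0 -lt0n fact_gt0.
have alg (a b d t : R) : a != 0 -> b != 0 -> (a * b)^-1 * (a * t * d) = d * (t / b).
  by move=> a0 b0; field; rewrite a0 b0.
exact: alg.
Qed.

Definition monomial (i1 i2 : 'I_n) (k l : nat) (x : X) : R :=
  divided_power i1 k x * divided_power i2 l x.

Lemma smooth_monomial (U : set X) i1 i2 k l : open U -> smooth_on U (monomial i1 i2 k l).
Proof. by move=> oU; apply: smooth_mul => //; apply: smooth_divided_power. Qed.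

Variables i1 i2 : 'I_n.
Hypothesis i12 : i1 != i2.

Let sdp i k x : differentiable (divided_power i k) x.
Proof.
by apply: smooth_differentiable (smooth_divided_power i k openT) _.
Qed.

Let partial_monomial j k l x : partial j (monomial i1 i2 k l) x =
  divided_power i1 k x * partial j (divided_power i2 l) x +
  divided_power i2 l x * partial j (divided_power i1 k) x.
Proof. by rewrite [LHS]deriveM //; exact: diff_derivable. Qed.

Lemma partial1_monomial k l x : partial i1 (monomial i1 i2 k l) x =
  if k is k'.+1 then monomial i1 i2 k' l x else 0.
Proof.
rewrite partial_monomial !partial_divided_power eqxx eq_sym (negPf i12) mul0r mulr0.
by rewrite add0r mul1r; case: k => [|k]; rewrite ?mulr0 // mulrC.
Qed.

Lemma partial2_monomial k l x : partial i2 (monomial i1 i2 k l) x =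
  if l is l'.+1 then monomial i1 i2 k l' x else 0.
Proof.
rewrite partial_monomial !partial_divided_power eqxx (negPf i12) mul0r mulr0.
by rewrite addr0 mul1r; case: l => [|l]; rewrite ?mulr0.
Qed.

Lemma partials2_monomial b k l : partials (nseq b i2) (monomial i1 i2 k l) =
  fun x => if (b <= l)%N then monomial i1 i2 k (l - b) x else 0.
Proof.
elim: b => [|b IH]; apply/funext => x /=; first by rewrite subn0.
rewrite IH /partial; case: (ltngtP b l) => bl.
- rewrite -[LHS]/(partial i2 (fun x => monomial i1 i2 k (l - b) x) x) partial2_monomial.
  by rewrite -(subnSK bl).
- exact: derive_cst.
- rewrite bl subnn -[LHS]/(partial i2 (fun x => monomial i1 i2 k 0 x) x).
  by rewrite partial2_monomial.
Qed.

Lemma partials1_monomial a k l : partials (nseq a i1) (monomial i1 i2 k l) =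
  fun x => if (a <= k)%N then monomial i1 i2 (k - a) l x else 0.
Proof.
elim: a => [|a IH]; apply/funext => x /=; first by rewrite subn0.
rewrite IH /partial; case: (ltngtP a k) => ak.
- rewrite -[LHS]/(partial i1 (fun x => monomial i1 i2 (k - a) l x) x) partial1_monomial.
  by rewrite -(subnSK ak).
- exact: derive_cst.
- rewrite ak subnn -[LHS]/(partial i1 (fun x => monomial i1 i2 0 l x) x).
  by rewrite partial1_monomial.
Qed.

Lemma monomial0 k l : monomial i1 i2 k l 0 = ((k == 0%N) && (l == 0%N))%:R.
Proof.
have d0 i m : divided_power i m (0 : X) = (m == 0%N)%:R.
  by rewrite /divided_power mxE expr0n; case: m => [|m]; rewrite ?fact0 ?divr1 ?mul0r.
by rewrite /monomial !d0 -natrM mulnb.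
Qed.

(** The divided monomials are dual to the evaluations at 0 of the mixed
derivatives. *)
Lemma mixed_jet_monomial a b k l :
  partials (nseq a i1 ++ nseq b i2) (partial i1 (monomial i1 i2 k.+1 l)) 0 =
  ((a == k) && (b == l))%:R.
Proof.
have -> : partial i1 (monomial i1 i2 k.+1 l) = monomial i1 i2 k l.
  by apply/funext => x; rewrite partial1_monomial.
rewrite /partials foldr_cat -!/(partials _ _) partials2_monomial.
case: (leqP b l) => bl.
  rewrite partials1_monomial; case: (leqP a k) => ak.
    by rewrite monomial0 !subn_eq0 (eqn_leq a) (eqn_leq b) ak bl.
  by rewrite (gtn_eqF ak).
by rewrite partials_cst0 (gtn_eqF bl) andbF.
Qed.

Lemma hessian_divided_square i j k x :
  partial i (partial j (divided_power k 2)) x = ((k == i) && (k == j))%:R.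
Proof.
have -> : partial j (divided_power k 2) = (k == j)%:R *: divided_power k 1.
  by apply/funext => y; rewrite partial_divided_power.
rewrite [LHS]deriveZ; last by apply: diff_derivable; apply: sdp.
rewrite -[X in _ *: X]/(partial i (divided_power k 1) x) partial_divided_power.
have -> : divided_power k 0 x = 1 by rewrite /divided_power expr0 fact0 divr1.
by case: (k == i); case: (k == j); rewrite ?scale1r ?scale0r ?mul1r ?mul0r.
Qed.

End Monomials.

(** * Cyclic vectors *)

(** A sum of eigenvectors e_i is cyclic: its Krylov matrix is the
Vandermonde matrix of the eigenvalues times the matrix of the e_i. *)
Lemma distinct_eigenvalues_cyclic (R : realType) (n : nat) (K : 'M[R]_n) (l : 'I_n -> R) :
  injective l -> (forall i, eigenvalue K (l i)) ->
  exists v : 'rV_n, \det (krylov v K) != 0.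
Proof.
move=> linj lK.
have /choice[e eP] : forall i, exists v : 'rV_n, v *m K = l i *: v /\ v != 0.
  by move=> i; have /eigenvalueP[v vK v0] := lK i; exists v.
have eexp i m : e i *m K ^+ m = l i ^+ m *: e i.
  elim: m => [|m IH]; first by rewrite !expr0 mulmx1 scale1r.
  by rewrite !exprS mulmxA (eP i).1 -scalemxAl IH scalerA.
pose V := Vandermonde n (\row_i l i).
pose E := \matrix_(i < n) e i.
have dV : \det V != 0.
  rewrite det_Vandermonde; apply/prodf_neq0 => i _; apply/prodf_neq0 => j ij.
  rewrite !mxE subr_eq0; apply/eqP => /linj ji; by rewrite ji ltnn in ij.
have VE u : V *m (diag_mx u *m E) = krylov (u *m E) K.
  apply/row_matrixP => m; rewrite rowK row_mul mulmxA -[in RHS]mulmxA.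
  rewrite [LHS]mulmx_sum_row [RHS]mulmx_sum_row.
  apply: eq_bigr => i _; rewrite [in RHS]row_mul !rowK eexp scalerA; congr (_ *: _).
  by rewrite mul_mx_diag !mxE mulrC.
(* const_mx 1 *m E is the sum of the eigenvectors. *)
exists (const_mx 1 *m E); rewrite -VE diag_const_mx mul1mx det_mulmx mulf_neq0 //.
rewrite -unitfE -unitmxE -row_free_unit; apply: inj_row_free => u uE.
have Vu : V \in unitmx by rewrite unitmxE unitfE.
have K0 : krylov (u *m E) K = 0.
  by apply/row_matrixP => m; rewrite rowK uE mul0mx row0.
have uE0 : diag_mx u *m E = 0 by rewrite -[LHS](mulKmx Vu) VE K0 mulmx0.
apply/rowP => j; rewrite [RHS]mxE; apply/eqP.
have /row_matrixP/(_ j)/eqP := uE0.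
have -> : row j (diag_mx u *m E) = u 0 j *: e j.
  by apply/rowP => k; rewrite mul_diag_mx !mxE.
by rewrite row0 scaler_eq0 (negPf (eP j).2) orbF.
Qed.

(** * Functions of action and angle coordinates *)

(** The two difference quotients are the same function of h. *)
Lemma derive_affine (R : realType) (V V' W : normedModType R) (g : V -> V')
    (f : V' -> W) (x v : V) (w : V') :
  (forall h : R, g (h *: v + x) = h *: w + g x) ->
  'D_v (fun y => f (g y)) x = 'D_w f (g x).
Proof.
move=> gE; rewrite /derive.
have -> : (fun h : R => h^-1 *: (((fun y => f (g y)) \o shift x) (h *: v) - f (g x))) =
  (fun h => h^-1 *: ((f \o shift (g x)) (h *: w) - f (g x))) by
  apply/funext => h /=; rewrite gE.
by [].
Qed.

Section Coordinates.
Variables (R : realType) (n : nat) (V : set 'rV[R]_n).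
Hypothesis oV : open V.
Local Notation X := 'rV[R]_n.
Local Notation coords := 'rV[R]_(n + n).

Lemma lsubmx_delta_l (i : 'I_n) : lsubmx (delta_mx 0 (lshift n i) : coords) = delta_mx 0 i.
Proof. by apply/rowP => j; rewrite !mxE eq_lshift. Qed.

Lemma lsubmx_delta_r (i : 'I_n) : lsubmx (delta_mx 0 (rshift n i) : coords) = 0.
Proof. by apply/rowP => j; rewrite !mxE eq_lrshift. Qed.

Lemma derive_lsubmx (W : normedModType R) (f : X -> W) v (z : coords) :
  'D_v (fun y : coords => f (lsubmx y)) z = 'D_(lsubmx v) f (lsubmx z).
Proof. by apply: derive_affine => h; rewrite linearP. Qed.

Lemma derive_row_mx (W : normedModType R) (f : coords -> W) v c x :
  'D_v (fun y : X => f (row_mx y c)) x = 'D_(row_mx v 0) f (row_mx x c).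
Proof.
apply: (derive_affine (g := fun y : X => row_mx y c)) => h.
by rewrite scale_row_mx add_row_mx scaler0 add0r.
Qed.

Lemma derive_translate (W : normedModType R) (f : coords -> W) v p z :
  'D_v (fun y => f (y + p)) z = 'D_v f (z + p).
Proof. by apply: (derive_affine (g := fun y => y + p)) => h; rewrite addrA. Qed.

Lemma partial_lsubmx_l (W : normedModType R) (f : X -> W) i z :
  partial (lshift n i) (fun y : coords => f (lsubmx y)) z = partial i f (lsubmx z).
Proof. by rewrite /partial derive_lsubmx lsubmx_delta_l. Qed.

Lemma partial_lsubmx_r (W : normedModType R) (f : X -> W) i z :
  partial (rshift n i) (fun y : coords => f (lsubmx y)) z = 0.
Proof. by rewrite /partial derive_lsubmx lsubmx_delta_r derive0. Qed.

Lemma row_mx_delta (i : 'I_n) :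
  row_mx (delta_mx 0 i) 0 = delta_mx 0 (lshift n i) :> coords.
Proof.
apply/rowP => j; rewrite !mxE; case: splitP => k jk; rewrite mxE.
  by rewrite (_ : j = lshift n k) ?eq_lshift //; apply: val_inj.
by rewrite (_ : j = rshift n k) ?eq_rlshift ?andbF //; apply: val_inj.
Qed.

Lemma partial_row_mx (W : normedModType R) (f : coords -> W) i c x :
  partial i (fun y : X => f (row_mx y c)) x = partial (lshift n i) f (row_mx x c).
Proof. by rewrite /partial derive_row_mx row_mx_delta. Qed.

Lemma open_M0 : open (M0 V).
Proof.
apply: (@open_comp _ _ (fun z : coords => lsubmx z)) oV => z _.
by apply: differentiable_continuous; exact: differentiable_lsubmx.
Qed.

Lemma smooth_lsubmx (W : normedModType R) (f : X -> W) :
  smooth_on V f -> smooth_on (M0 V) (fun z : coords => f (lsubmx z)).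
Proof.
move=> sf; apply: (@smooth_coind _ _ _ open_M0 W
  (fun g => exists2 f, smooth_on V f & g = fun z => f (lsubmx z))); last by exists f.
move=> _ {sf f} [f sf ->]; split.
  move=> z Vz; apply: (@differentiable_comp _ _ _ _ (fun y : coords => lsubmx y) f).
    exact: differentiable_lsubmx.
  exact: smooth_differentiable sf Vz.
move=> i; rewrite -(fintype.splitK i); case: (fintype.split i) => k /=.
  exists (fun z => partial k f (lsubmx z)); last by move=> z _; rewrite partial_lsubmx_l.
  by exists (partial k f) => //; apply: smooth_partial.
exists (fun z => 0); last by move=> z _; rewrite partial_lsubmx_r.
by exists (fun=> 0) => //; apply: smooth_cst.
Qed.

Lemma differentiable_row_mx (c : X) x : differentiable (fun y : X => row_mx y c : coords) x.
Proof.
have -> : (fun y : X => row_mx y c : coords) =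
   (fun y => (\sum_i (fun i (y : X) => y 0 i *: delta_mx 0 (lshift n i)) i) y + row_mx 0 c).
  apply/funext => y; rewrite -[in LHS](add0r c) -[in LHS](addr0 y) -add_row_mx.
  congr (_ + _); rewrite fct_sumE {1}(row_sum_delta y).
  apply/rowP => j; rewrite summxE mxE; case: splitP => k jk.
    rewrite summxE; apply: eq_bigr => i _; rewrite !mxE.
    by rewrite (_ : j = lshift n k) ?eq_lshift //; apply: val_inj.
  rewrite mxE big1 // => i _; rewrite !mxE.
  by rewrite (_ : j = rshift n k) ?eq_rlshift ?andbF ?mulr0 //; apply: val_inj.
apply: differentiableD; last exact: differentiable_cst.
apply: differentiable_sum => i; apply: differentiableZl; exact: differentiable_coord.
Qed.

Lemma smooth_row_mx (W : normedModType R) (f : coords -> W) (c : X) :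
  smooth_on (M0 V) f -> smooth_on V (fun x => f (row_mx x c)).
Proof.
move=> sf; apply: (@smooth_coind _ _ _ oV W
  (fun g => exists2 f, smooth_on (M0 V) f & g = fun x => f (row_mx x c))); last by exists f.
move=> _ {sf f} [f sf ->]; split.
  move=> x Vx; apply: (@differentiable_comp _ _ _ _ (fun y : X => row_mx y c) f).
    exact: differentiable_row_mx.
  by apply: smooth_differentiable sf _; rewrite /M0 /= row_mxKl.
move=> i; exists (fun x => partial (lshift n i) f (row_mx x c)).
  by exists (partial (lshift n i) f) => //; apply: smooth_partial.
by move=> x _; rewrite partial_row_mx.
Qed.

Implicit Types f : coords -> R.

Lemma periodic_partial f i : angle_periodic V f -> angle_periodic V (partial i f).
Proof.
move=> pf z k Vz; rewrite /partial -derive_translate.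
by apply: near_eq_derive; apply: (near_eq_on open_M0 Vz) => y Vy; apply: pf.
Qed.

Let period (k : 'I_n) : coords := (2 * pi) *: delta_mx 0 (rshift n k).

Lemma M0_add z v : lsubmx v = 0 -> M0 V (z + v) = M0 V z.
Proof. by move=> v0; rewrite /M0 /= linearD /= v0 addr0. Qed.

Lemma lsubmx_period m k : lsubmx (m *: period k) = 0.
Proof. by rewrite !linearZ /= lsubmx_delta_r !scaler0. Qed.

Lemma periodic_nat f z k (m : nat) : angle_periodic V f -> M0 V z ->
  f (z + m%:R *: period k) = f z.
Proof.
move=> pf Vz; elim: m => [|m IH]; first by rewrite scale0r addr0.
by rewrite -natr1 scalerDl scale1r addrA pf // M0_add // lsubmx_period.
Qed.

Lemma periodic_int f z k (m : int) : angle_periodic V f -> M0 V z ->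
  f (z + m%:~R *: period k) = f z.
Proof.
move=> pf Vz; case: m => m; first exact: periodic_nat.
rewrite NegzE mulrNz scaleNr -(periodic_nat k m.+1 pf (z := _ - _)) ?subrK //.
by rewrite -scaleNr M0_add // lsubmx_period.
Qed.

Lemma periodic_sum f z (r : seq 'I_n) (m : 'I_n -> int) : angle_periodic V f -> M0 V z ->
  f (z + \sum_(k <- r) (m k)%:~R *: period k) = f z.
Proof.
move=> pf; elim: r z => [|k r IH] z Vz; first by rewrite big_nil addr0.
rewrite big_cons addrA IH; first exact: periodic_int.
by rewrite M0_add // lsubmx_period.
Qed.

(** By periodicity the values on a torus are those on the compact cube
[0, 2 pi]^n. *)
Lemma periodic_bounded f x : V x -> (forall z, M0 V z -> {for z, continuous f}) ->
  angle_periodic V f -> exists2 B, 0 <= B & forall z, lsubmx z = x -> `|f z| <= B.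
Proof.
move=> Vx cf pf.
(* the actions are frozen at x and the angles range over a period *)
pose S (i : 'I_(n + n)) : set R := match fintype.split i with
  inl k => `[x 0 k, x 0 k]%classic | inr _ => `[0, 2 * pi]%classic end.
have cS : compact [set z : coords | forall i, S i (z 0 i)].
  by apply: rV_compact => i; rewrite /S; case: fintype.split => k; exact: segment_compact.
set A := [set z : coords | _] in cS.
have Al z : A z -> lsubmx z = x.
  move=> Az; apply/rowP => k; have := Az (lshift n k).
  rewrite /S (fintype.unsplitK (inl k)) /= in_itv /= mxE => /andP[? ?].
  by apply/eqP; rewrite eq_le; apply/andP.
have reduce z : lsubmx z = x -> exists2 y, A y & f y = f z.
  move=> zx; pose m k := - Num.floor (z 0 (rshift n k) / (2 * pi)).
  have p0 : 0 < 2 * pi :> R by rewrite mulr_gt0 ?pi_gt0.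
  exists (z + \sum_(k <- index_enum 'I_n) (m k)%:~R *: period k); last first.
    by rewrite periodic_sum // /M0 /= zx.
  have ls : lsubmx (\sum_(k <- index_enum 'I_n) (m k)%:~R *: period k) = 0.
    by rewrite linear_sum big1 // => k _; exact: lsubmx_period.
  move=> i; rewrite /S -(fintype.splitK i); case: (fintype.split i) => k /=.
    have := congr1 (fun y : X => y 0 k) ls; rewrite (fintype.unsplitK (inl k)) /= in_itv /= !mxE => ->.
    by rewrite addr0 -zx mxE lexx.
  rewrite (fintype.unsplitK (inr k)) /= mxE summxE (bigD1 k) //= big1 ?addr0; last first.
    move=> l lk; rewrite !mxE eqxx eq_rshift eq_sym (negPf lk) !mulr0 //.
  rewrite !mxE !eqxx mulr1 in_itv /= /m mulrNz mulNr.
  set t := z 0 _; set p : R := 2 * pi in p0 *; move: p p0 => p p0.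
  have := floor_itv (t / p).
  rewrite ler_pdivlMr // ltr_pdivrMr // intrD mulrDl mul1r => /andP[a b].
  by rewrite subr_ge0 a /= lerBlDl ltW.
have [A0|nA] := pselect (A !=set0); last first.
  by exists 0 => // z zx; exfalso; apply: nA; have [y Ay _] := reduce z zx; exists y.
have cfA : {within A, continuous (fun z => `|f z|)}.
  apply: continuous_in_subspaceT => z; rewrite inE => /Al zx.
  apply: continuous_comp; last exact: norm_continuous.
  by apply: cf; rewrite /M0 /= zx.
have [c _ cmax] := compact_EVT_max A0 cS cfA.
exists `|f c| => // z zx; have [y Ay <-] := reduce z zx.
by apply: cmax; rewrite inE.
Qed.

End Coordinates.

(** * Functions along the Hamiltonian flow *)

Section Flow.
Variables (R : realType) (n : nat) (V : set 'rV[R]_n).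
Hypothesis oV : open V.
Local Notation X := 'rV[R]_n.
Local Notation coords := 'rV[R]_(n + n).
Local Notation dx i := (partial (lshift n i)).
Local Notation dtheta i := (partial (rshift n i)).

Let oM : open (M0 V). Proof. exact: open_M0. Qed.

Lemma bounded_growth (b c : R) : (forall h, 0 < h -> `|c| * h <= b) -> c = 0.
Proof.
move=> H; apply/eqP/negPn/negP => c0.
have b0 : 0 <= b by apply: le_trans (H 1 ltr01); rewrite mulr1.
have cn : 0 < `|c| by rewrite normr_gt0.
have := H ((b + 1) / `|c|) (divr_gt0 (ltr_wpDl b0 ltr01) cn).
by rewrite mulrC divfK ?gt_eqF // gerDl ler10.
Qed.

(** Along the orbit of u the function f is affine of slope c z, and it is
bounded by [periodic_bounded]. *)
Lemma flow_bounded (f c : coords -> R) (u z : coords) :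
  lsubmx u = 0 -> M0 V z -> smooth_on (M0 V) f -> angle_periodic V f ->
  smooth_on (M0 V) c ->
  (forall y, lsubmx y = lsubmx z -> 'D_u f y = c y) ->
  (forall y, lsubmx y = lsubmx z -> 'D_u c y = 0) ->
  c z = 0.
Proof.
move=> u0 Vz sf pf sc fc c0.
have fiber (s : R) : lsubmx (s *: u + z) = lsubmx z.
  by rewrite linearP /= u0 scaler0 add0r.
have Vs (s : R) : M0 V (s *: u + z) by rewrite /M0 /= fiber.
have cE (h : R) : 0 < h -> c (h *: u + z) = c z.
  move=> h0; have [|s _ E] := @mean_value_line R _ c z u h h0.
    by move=> s _; apply: diff_derivable; apply: smooth_differentiable sc _.
  by apply/eqP; rewrite -subr_eq0 E c0 ?fiber // mul0r.
have [B B0 fB] := @periodic_bounded R n V f (lsubmx z) Vz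
  (fun y Vy => differentiable_continuous (smooth_differentiable sf Vy)) pf.
apply: (@bounded_growth (B + B)) => h h0.
have [|s /andP[s0 _] E] := @mean_value_line R _ f z u h h0.
  by move=> s _; apply: diff_derivable; apply: smooth_differentiable sf _.
have cs : c (s *: u + z) = c z.
  by move: s0; rewrite le_eqVlt => /predU1P[<-|/cE //]; rewrite scale0r add0r.
rewrite -cs -fc ?fiber // -(gtr0_norm h0) -normrM -E.
by apply: (le_trans (ler_normB _ _)); apply: lerD; apply: fB; rewrite ?fiber.
Qed.

Variable H : X -> R.
Hypothesis sH : smooth_on V H.
Definition hessian (x : X) : 'M[R]_n := \matrix_(i, k) partial i (partial k H) x.
Hypothesis ndeg : forall x, V x -> hessian x \in unitmx.

Definition frequency (x : X) : coords := row_mx 0 (\row_k partial k H x).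

Lemma lsubmx_frequency x : lsubmx (frequency x) = 0.
Proof. exact: row_mxKl. Qed.

Lemma smooth_M0_differentiable (f : coords -> R) z : smooth_on (M0 V) f -> M0 V z ->
  differentiable f z.
Proof. exact: smooth_differentiable. Qed.

Lemma derive_row_mx0 (f : coords -> R) z (w : X) : differentiable f z ->
  'D_(row_mx 0 w) f z = \sum_k w 0 k * dtheta k f z.
Proof.
move=> df; rewrite derive_partial // big_split_ord /= big1 ?add0r; last first.
  by move=> i _; rewrite row_mxEl mxE scale0r.
by apply: eq_bigr => k _; rewrite row_mxEr.
Qed.

Lemma derive_frequency (f : coords -> R) x z : smooth_on (M0 V) f -> M0 V z ->
  'D_(frequency x) f z = \sum_k partial k H x * dtheta k f z.
Proof.
move=> sf Vz; rewrite derive_row_mx0; last exact: smooth_M0_differentiable.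
by apply: eq_bigr => k _; rewrite mxE.
Qed.

Lemma smooth_gradient k : smooth_on V (partial k H).
Proof. exact: smooth_partial. Qed.

Lemma partial_comm (U : set coords) (f : coords -> R) i j z : open U -> smooth_on U f ->
  U z -> partial i (partial j f) z = partial j (partial i f) z.
Proof. by move=> oU sf Uz; exact: (smooth_derive_comm oU _ _ sf Uz). Qed.

Lemma derive_combination (I : finType) (s : I -> R) (h : I -> coords -> R) u z :
  (forall k, differentiable (h k) z) ->
  'D_u (fun y => \sum_k s k * h k y) z = \sum_k s k * 'D_u (h k) z.
Proof.
move=> dh.
suff : is_derive z u (fun y => \sum_k s k * h k y) (\sum_k s k * 'D_u (h k) z) by case.
elim: (index_enum I) => [|k r IH].
  have -> : (fun y => \sum_(k <- [::]) s k * h k y) = cst 0.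
    by apply/funext => y; rewrite big_nil.
  by rewrite big_nil; exact: is_derive_cst.
have -> : (fun y => \sum_(i <- k :: r) s i * h i y) =
  (fun y => (s k *: h k) y + (fun y => \sum_(i <- r) s i * h i y) y).
  by apply/funext => y; rewrite big_cons.
rewrite big_cons; apply: is_deriveD; split.
  by apply: derivableZ; apply: diff_derivable.
by rewrite deriveZ //; apply: diff_derivable.
Qed.

(** The form in which [flow_bounded] is used: the derivative of f on the
torus of z is a combination of invariant functions, with coefficients that are
constant on this torus. *)
Lemma flow_combination (I : finType) (f : coords -> R) (s : I -> R)
    (h : I -> coords -> R) z :
  M0 V z -> smooth_on (M0 V) f -> angle_periodic V f ->
  (forall k, smooth_on (M0 V) (h k)) ->
  (forall y, lsubmx y = lsubmx z ->
    'D_(frequency (lsubmx z)) f y = \sum_k s k * h k y) ->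
  (forall k y, lsubmx y = lsubmx z -> 'D_(frequency (lsubmx z)) (h k) y = 0) ->
  \sum_k s k * h k z = 0.
Proof.
move=> Vz sf pf sh fE h0.
pose c y := \sum_k s k * h k y.
have sc : smooth_on (M0 V) c by apply: (smooth_sum oM) => k; apply: (smooth_scale oM).
have c0 y : lsubmx y = lsubmx z -> 'D_(frequency (lsubmx z)) c y = 0.
  move=> yz; have Vy : M0 V y by rewrite /M0 /= yz.
  rewrite derive_combination => [|k]; last exact: smooth_M0_differentiable.
  by rewrite big1 // => k _; rewrite h0 // mulr0.
exact: (flow_bounded (lsubmx_frequency _) Vz sf pf sc fE c0).
Qed.

Lemma hessian_solve (x : X) (w : 'I_n -> R) : V x ->
  (forall i, \sum_k partial i (partial k H) x * w k = 0) -> forall k, w k = 0.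
Proof.
move=> Vx w0 k.
have : hessian x *m (\col_k w k) = 0.
  apply/colP => i; rewrite !mxE -[RHS](w0 i); apply: eq_bigr => l _.
  by rewrite !mxE.
move/(congr1 (mulmx (invmx (hessian x)))).
by rewrite mulKmx ?ndeg // mulmx0 => /colP/(_ k); rewrite !mxE.
Qed.

(** Differentiating X_H f = 0 in x_i shows that the derivative of d_{x_i} f
along X_H is - sum_k S_ik d_{theta_k} f, a combination of invariant functions;
it vanishes by [flow_combination] and S is invertible. *)
Lemma invariant_theta (f : coords -> R) :
  smooth_on (M0 V) f -> angle_periodic V f ->
  (forall z, M0 V z -> \sum_k partial k H (lsubmx z) * dtheta k f z = 0) ->
  forall z k, M0 V z -> dtheta k f z = 0.
Proof.
move=> sf pf inv.
have sg k : smooth_on (M0 V) (fun z : coords => partial k H (lsubmx z)).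
  by apply: smooth_lsubmx => //; exact: smooth_gradient.
have sp i : smooth_on (M0 V) (partial i f) by exact: smooth_partial.
have diff_inv j z : M0 V z -> \sum_k partial j (fun y : coords => partial k H (lsubmx y)) z * dtheta k f z
   + \sum_k partial k H (lsubmx z) * partial j (dtheta k f) z = 0.
  move=> Vz.
  have : partial j (fun z => \sum_k partial k H (lsubmx z) * dtheta k f z) z = 0.
    rewrite /partial; transitivity ('D_(delta_mx 0 j) (fun _ : coords => 0 : R) z).
      by apply: near_eq_derive; apply: (near_eq_on oM Vz) => y Vy; rewrite inv.
    by rewrite derive_cst.
  by rewrite (partial_sum_mul oM).
move=> z l Vz; move: l; apply: (hessian_solve Vz) => i.
apply/eqP; rewrite -oppr_eq0 -sumrN; apply/eqP.
under eq_bigr do rewrite -mulNr.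
apply: (flow_combination (f := dx i f) (h := fun k => dtheta k f) Vz (sp _)
  (periodic_partial oV _ pf) (fun k => sp _)) => [y yz|k y yz].
  have Vy : M0 V y by rewrite /M0 /= yz.
  rewrite derive_frequency //; have := diff_inv (lshift n i) y Vy.
  rewrite addrC => /eqP; rewrite addr_eq0 => /eqP E.
  under eq_bigr => k _ do rewrite -yz (partial_comm _ _ oM sf Vy).
  rewrite E -sumrN; apply: eq_bigr => k _.
  by rewrite partial_lsubmx_l yz mulNr.
have Vy : M0 V y by rewrite /M0 /= yz.
rewrite derive_frequency //; have := diff_inv (rshift n k) y Vy.
have -> : \sum_j partial (rshift n k) (fun y : coords => partial j H (lsubmx y)) y *
    dtheta j f y = 0.
  by apply: big1 => j _; rewrite [X in X * _]partial_lsubmx_r mul0r.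
rewrite add0r.
have comm j : dtheta j (dtheta k f) y = dtheta k (dtheta j f) y.
  exact: partial_comm oM sf Vy.
move=> E; rewrite -[RHS]E -yz; apply: eq_bigr => j _; by rewrite comm.
Qed.

End Flow.

(** * The mixed block of the second symplectic form *)

Lemma alternating_sum3_eq0 (R : zmodType) (a b c : R) : a - b + c = 0 -> a = b - c.
Proof. by move=> /eqP; rewrite -addrA (addrC _ c) addr_eq0 opprB => /eqP. Qed.

Lemma balanced_sum_eq0 (R : zmodType) (a b c d : R) : a + b - (c + d) = 0 -> b - d = c - a.
Proof.
move=> /eqP; rewrite subr_eq0 => /eqP E.
by rewrite -(addKr a b) E addrA addrK addrC.
Qed.

(** The shape of the torsion on two constant fields, where the derivatives
of the constant fields are 0. *)
Lemma torsion_entry (R : realType) (m : nat) (p q c d : 'rV[R]_m) (M : 'M[R]_m) k a1 a2 a3 a4 :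
  p - q - (0 - c) *m M - (d - 0) *m M + (0 - 0) *m M *m M = 0 ->
  p 0 k = a1 -> q 0 k = a2 -> (c *m M) 0 k = a3 -> (d *m M) 0 k = a4 ->
  a1 - a2 + a3 - a4 = 0.
Proof.
rewrite subrr sub0r subr0 !mul0mx addr0 mulNmx opprK => /rowP /(_ k) E <- <- <- <-.
have entry (x y z t : 'rV[R]_m) : (x - y + z - t) 0 k = x 0 k - y 0 k + z 0 k - t 0 k.
  by rewrite !mxE.
by rewrite -entry E mxE.
Qed.

Section BiHamiltonian.
#[local] Opaque derive.
Variables (R : realType) (n : nat) (U V : set 'rV[R]_n).
Hypothesis oV : open V.
Hypothesis VU : V `<=` U.
Local Notation X := 'rV[R]_n.
Local Notation coords := 'rV[R]_(n + n).
Local Notation dtheta i := (partial (rshift n i)).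
Variable H : X -> R.
Hypothesis sH : smooth_on V H.
Hypothesis ndeg : forall x, V x -> hessian H x \in unitmx.
Variables (W : coords -> 'M[R]_(n + n)) (XH : coords -> 'rV[R]_(n + n)).
Hypothesis W_symplectic : symplectic_form U W.
Hypothesis XH_ham : hamiltonian_vector_field U H XH.
Hypothesis XH_closed : forall z, M0 U z -> ext_d1 (interior_product XH W) z = 0.

Let oM : open (M0 V). Proof. exact: open_M0. Qed.

Local Notation w i j := (fun y => W y i j).
Local Notation G k := (fun y : coords => partial k H (lsubmx y)).

Let MU z : M0 V z -> M0 U z. Proof. exact: VU. Qed.

Let sw i j : smooth_on (M0 V) (w i j).
Proof.
have [[sW _] _ _ _] := W_symplectic.
by apply: (smooth_entry oM); apply: smooth_subset sW => z /MU.
Qed.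

Let pw i j : angle_periodic V (w i j).
Proof.
have [[_ pW] _ _ _] := W_symplectic.
by move=> z k /MU Uz; rewrite pW.
Qed.

Let skew i j z : M0 V z -> W z j i = - W z i j.
Proof.
have [_ sk _ _] := W_symplectic.
by move=> /MU /sk /matrixP /(_ i j); rewrite !mxE.
Qed.

Let closedW i j k z : M0 V z ->
  partial i (w j k) z - partial j (w i k) z + partial k (w i j) z = 0.
Proof. by have [_ _ _ cW] := W_symplectic; move=> /MU Uz; exact: cW. Qed.

Let sG k : smooth_on (M0 V) (G k).
Proof. by apply: smooth_lsubmx => //; apply: smooth_partial. Qed.

Lemma hamiltonian_vectorE z : M0 V z -> XH z = frequency H (lsubmx z).
Proof.
move=> /MU Uz; have [_ /(_ z Uz)] := XH_ham.
rewrite /interior_product /omega0 -{1}(hsubmxK (XH z)) mul_row_block.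
rewrite !mulmx0 !mulmx1 mulmxN mulmx1 add0r addr0 => E.
rewrite -(hsubmxK (XH z)) /frequency; congr row_mx.
  have /(congr1 rsubmx) := E; rewrite row_mxKr => ->.
  by apply/rowP => k; rewrite !mxE partial_lsubmx_r oppr0.
have /(congr1 lsubmx)/(congr1 -%R) := E; rewrite row_mxKl opprK => ->.
by apply/rowP => k; rewrite !mxE opprK partial_lsubmx_l.
Qed.

Definition dfrequency i k (z : coords) : R := partial i (G k) z.

Lemma dfrequency_theta i k z : dfrequency (rshift n i) k z = 0.
Proof. exact: (@partial_lsubmx_r R n R (partial k H)). Qed.

Lemma dfrequency_x i k z : dfrequency (lshift n i) k z = partial i (partial k H) (lsubmx z).
Proof. exact: (@partial_lsubmx_l R n R (partial k H)). Qed.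

(** The identity L_{X_H} omega_1 = 0, obtained from Cartan's formula: both
omega_1 and the contraction of X_H with omega_1 are closed. *)
Lemma lie_w i j z : M0 V z ->
  \sum_k partial k H (lsubmx z) * dtheta k (w i j) z =
  \sum_k dfrequency j k z * W z (rshift n k) i -
  \sum_k dfrequency i k z * W z (rshift n k) j.
Proof.
move=> Vz.
have iE a y : M0 V y -> interior_product XH W y 0 a = \sum_k G k y * W y (rshift n k) a.
  move=> Vy; rewrite /interior_product hamiltonian_vectorE // mxE big_split_ord /=.
  rewrite big1 ?add0r => [|k _]; last by rewrite row_mxEl mxE mul0r.
  by apply: eq_bigr => k _; rewrite row_mxEr mxE.
have diE a b : partial b (fun y => interior_product XH W y 0 a) z =
    \sum_k partial b (G k) z * W z (rshift n k) a +
    \sum_k G k z * partial b (w (rshift n k) a) z.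
  rewrite -(partial_sum_mul oM) //; apply: near_eq_derive.
  by apply: (near_eq_on oM Vz) => y; exact: iE.
have /matrixP /(_ i j) := XH_closed (MU Vz).
rewrite /ext_d1 !mxE !diE => E.
have -> : \sum_k partial k H (lsubmx z) * dtheta k (w i j) z =
    \sum_k G k z * partial i (w (rshift n k) j) z -
    \sum_k G k z * partial j (w (rshift n k) i) z.
  rewrite -sumrB; apply: eq_bigr => k _; rewrite -mulrBr; congr (_ * _).
  exact: alternating_sum3_eq0 (closedW (rshift n k) i j Vz).
exact: balanced_sum_eq0 E.
Qed.

#[local] Opaque dfrequency.

Local Notation S i k x := (partial i (partial k H) x).

Let theta_gradient k b z :
  \sum_m dfrequency (rshift n k) m z * W z (rshift n m) b = 0.
Proof. by apply: big1 => m _; rewrite dfrequency_theta mul0r. Qed.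

Let x_gradient k b z : \sum_m dfrequency (lshift n k) m z * W z (rshift n m) b =
  \sum_m S k m (lsubmx z) * W z (rshift n m) b.
Proof. by apply: eq_bigr => m _; rewrite dfrequency_x. Qed.

Lemma lie_theta_theta k l z : M0 V z ->
  \sum_m partial m H (lsubmx z) * dtheta m (w (rshift n k) (rshift n l)) z = 0.
Proof.
move=> Vz; rewrite (lie_w _ _ Vz).
by rewrite !theta_gradient subr0.
Qed.

Lemma lie_x_theta i l z : M0 V z ->
  \sum_m partial m H (lsubmx z) * dtheta m (w (lshift n i) (rshift n l)) z =
  \sum_m - S i m (lsubmx z) * W z (rshift n m) (rshift n l).
Proof.
move=> Vz; rewrite (lie_w _ _ Vz) theta_gradient x_gradient sub0r -sumrN.
by apply: eq_bigr => m _; rewrite mulNr.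
Qed.

Lemma lie_x_x i j z : M0 V z ->
  \sum_m partial m H (lsubmx z) * dtheta m (w (lshift n i) (lshift n j)) z =
  \sum_m S j m (lsubmx z) * W z (rshift n m) (lshift n i) -
  \sum_m S i m (lsubmx z) * W z (rshift n m) (lshift n j).
Proof.
move=> Vz; have E := lie_w (lshift n i) (lshift n j) Vz.
rewrite (x_gradient j (lshift n i) z) in E.
by rewrite (x_gradient i (lshift n j) z) in E; exact: E.
Qed.

(** The derivative of B along the flow is - S C, and C is invariant. *)
Lemma theta_theta_eq0 k l z : M0 V z -> W z (rshift n k) (rshift n l) = 0.
Proof.
move=> Vz.
refine (hessian_solve ndeg (x := lsubmx z) (w := fun k => W z (rshift n k) (rshift n l)) Vz _ k).
move=> i.
apply/eqP; rewrite -oppr_eq0 -sumrN; apply/eqP.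
under eq_bigr do rewrite -mulNr.
apply: (flow_combination oV (H := H) (f := w (lshift n i) (rshift n l))
  (h := fun k => w (rshift n k) (rshift n l)) Vz (sw _ _) (@pw _ _) (fun k => sw _ _)).
- move=> y yz; have Vy : M0 V y by rewrite /M0 /= yz.
  by rewrite (derive_frequency H _ (sw _ _) Vy) -yz lie_x_theta.
- move=> m y yz; have Vy : M0 V y by rewrite /M0 /= yz.
  by rewrite (derive_frequency H _ (sw _ _) Vy) -yz lie_theta_theta.
Qed.

Lemma x_theta_invariant i l z k : M0 V z -> dtheta k (w (lshift n i) (rshift n l)) z = 0.
Proof.
apply: (invariant_theta oV sH ndeg (sw _ _) (@pw _ _)) => y Vy.
by rewrite lie_x_theta // big1 // => m _; rewrite theta_theta_eq0 // mulr0.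
Qed.

Lemma theta_x_invariant i l z k : M0 V z -> dtheta k (w (rshift n l) (lshift n i)) z = 0.
Proof.
move=> Vz; rewrite /partial.
transitivity ('D_(delta_mx 0 (rshift n k)) (- (w (lshift n i) (rshift n l))) z).
  by apply: near_eq_derive; apply: (near_eq_on oM Vz) => y Vy; exact: skew.
rewrite deriveN; first by apply/eqP; rewrite oppr_eq0; apply/eqP; exact: x_theta_invariant.
by apply: diff_derivable; apply: smooth_differentiable (sw _ _) Vz.
Qed.

(** The derivative of A along the flow is the skew part of the product of S
and B, which is invariant because B does not depend on theta. *)
Lemma hessian_mixed_sym i j z : M0 V z ->
  \sum_m S i m (lsubmx z) * W z (rshift n m) (lshift n j) =
  \sum_m S j m (lsubmx z) * W z (rshift n m) (lshift n i).
Proof.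
move=> Vz; apply/eqP; rewrite eq_sym -subr_eq0 -sumrN; apply/eqP.
pose s (a : 'I_n + 'I_n) := match a with
  inl m => S j m (lsubmx z) | inr m => - S i m (lsubmx z) end.
pose h (a : 'I_n + 'I_n) : coords -> R := match a with
  inl m => w (rshift n m) (lshift n i) | inr m => w (rshift n m) (lshift n j) end.
have -> : \sum_m S j m (lsubmx z) * W z (rshift n m) (lshift n i) +
   \sum_m - (S i m (lsubmx z) * W z (rshift n m) (lshift n j)) = \sum_a s a * h a z.
  rewrite big_sumType /=; congr (_ + _); by apply: eq_bigr => m _; rewrite mulNr.
have sh a : smooth_on (M0 V) (h a) by case: a => m; exact: sw.
apply: (flow_combination oV (H := H) (f := w (lshift n i) (lshift n j)) Vz (sw _ _) (@pw _ _) sh).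
- move=> y yz; have Vy : M0 V y by rewrite /M0 /= yz.
  rewrite (derive_frequency H _ (sw _ _) Vy) -yz lie_x_x // big_sumType /= yz -sumrN.
  by congr (_ + _); apply: eq_bigr => m _; rewrite mulNr.
- move=> a y yz; have Vy : M0 V y by rewrite /M0 /= yz.
  rewrite (derive_frequency H _ (sh a) Vy) big1 // => k _.
  by case: a => m; rewrite [X in _ * X]theta_x_invariant // mulr0.
Qed.

Lemma x_x_invariant i j z k : M0 V z -> dtheta k (w (lshift n i) (lshift n j)) z = 0.
Proof.
apply: (invariant_theta oV sH ndeg (sw _ _) (@pw _ _)) => y Vy.
by rewrite lie_x_x // hessian_mixed_sym // subrr.
Qed.

Definition mixed_block (x : X) : 'M[R]_n := ursubmx (W (row_mx x 0)).
Local Notation K := mixed_block.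

Let V0 x : V x -> M0 V (row_mx x 0). Proof. by rewrite /M0 /= row_mxKl. Qed.

Lemma mixed_blockE x i j : K x i j = W (row_mx x 0) (lshift n i) (rshift n j).
Proof. by rewrite !mxE. Qed.

Lemma smooth_mixed_block i j : smooth_on V (fun x => K x i j).
Proof.
apply: (smooth_ext oV) (smooth_row_mx oV 0 (sw (lshift n i) (rshift n j))).
by move=> x _; rewrite mixed_blockE.
Qed.

Lemma partial_mixed_block i j k x :
  partial k (fun y => K y i j) x = partial (lshift n k) (w (lshift n i) (rshift n j)) (row_mx x 0).
Proof.
rewrite -partial_row_mx; congr (partial k _ x).
by apply/funext => y; rewrite mixed_blockE.
Qed.

(** Closedness of omega_1 on (d/dx_i, d/dx_k, d/dtheta_j); the remaining
term is a theta derivative of the (dx, dx) block. *)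
Lemma mixed_block_closed i j k x : V x ->
  partial i (fun y => K y k j) x = partial k (fun y => K y i j) x.
Proof.
move=> /V0 Vx; rewrite !partial_mixed_block.
have := closedW (lshift n i) (lshift n k) (rshift n j) Vx.
by rewrite x_x_invariant // addr0 => /eqP; rewrite subr_eq0 => /eqP.
Qed.

Lemma mixed_block_hessian i j x : V x ->
  \sum_c K x i c * partial c (partial j H) x = \sum_c K x j c * partial i (partial c H) x.
Proof.
move=> Vx; have := hessian_mixed_sym i j (V0 Vx); rewrite row_mxKl => E.
transitivity (- \sum_m S j m x * W (row_mx x 0) (rshift n m) (lshift n i)).
  rewrite -sumrN; apply: eq_bigr => c _.
  rewrite mixed_blockE (skew (rshift n c) (lshift n i) (V0 Vx)) mulNr mulrC.
  have comm : partial c (partial j H) x = partial j (partial c H) x.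
    exact: (smooth_derive_comm oV _ _ sH Vx).
  by rewrite comm.
rewrite -E -sumrN; apply: eq_bigr => c _.
by rewrite mixed_blockE (skew (rshift n c) (lshift n j) (V0 Vx)) mulNr mulrC.
Qed.

Variable J : coords -> 'M[R]_(n + n).
Hypothesis JW : recursion_operator U W J.
Hypothesis torsionJ : nijenhuis_torsion_free U J.

Let const_field (v : coords) : vector_field U (fun _ : coords => v).
Proof.
split=> // l z _.
suff : smooth_on setT (fun _ : coords => v) by apply.
exact: (smooth_cst openT).
Qed.

Lemma recursion_operatorE z : M0 U z -> J z *m omega0 z = W z.
Proof.
move=> Uz; have [_ JWz] := JW; apply/matrixP => i j.
have := JWz _ _ (const_field (delta_mx 0 i)) (const_field (delta_mx 0 j)) z Uz.
rewrite /form_eval /apply_tensor -mulmxA -!rowE -mulmxA trmx_delta -!colE => E.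
move: E; have -> : row i (J z) *m col j (omega0 z) = row i (col j (J z *m omega0 z)).
  by rewrite !rowE !colE !mulmxA.
by rewrite ![row i _ 0 0]mxE ![col j _ i 0]mxE => ->.
Qed.

Let JE z i j : M0 V z -> J z i (lshift n j) = W z i (rshift n j).
Proof.
move=> Vz; have E := recursion_operatorE (MU Vz).
have : lsubmx (J z) = rsubmx (W z).
  rewrite -E -{2}(hsubmxK (J z)) /omega0 mul_row_block row_mxKr.
  by rewrite mulmx1 mulmx0 addr0.
by move=> /matrixP /(_ i j); rewrite !mxE.
Qed.

(** The recursion operator is block triangular with diagonal blocks K and
its transpose. *)
Lemma eigenvalue_mixed_block x a : V x -> eigenvalue (J (row_mx x 0)) a -> eigenvalue (K x) a.
Proof.
move=> Vx; set Jx := J _ => /eigenvalueP[v vJ v0].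
have J_l : lsubmx Jx = col_mx (K x) 0.
  apply/matrixP => i j; rewrite mxE (JE _ _ (V0 Vx)) mxE; case: splitP => k ik.
    by rewrite mixed_blockE (_ : i = lshift n k) //; apply: val_inj.
  by rewrite (_ : i = rshift n k) ?(theta_theta_eq0 _ _ (V0 Vx)) ?mxE //; apply: val_inj.
have J_dr : dsubmx (rsubmx Jx) = (K x)^T.
  have E := recursion_operatorE (MU (V0 Vx)).
  have : lsubmx (W (row_mx x 0)) = - rsubmx Jx.
    rewrite -E -[J _]/Jx -{1}(hsubmxK Jx) /omega0 mul_row_block row_mxKl.
    by rewrite mulmx0 add0r mulmxN mulmx1.
  move=> EJ; apply/matrixP => i j; rewrite [RHS]mxE mixed_blockE.
  rewrite (skew (rshift n i) (lshift n j) (V0 Vx)).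
  have := congr1 (fun M : 'M[R]_(n + n, n) => M (rshift n i) j) EJ.
  by rewrite mxE => ->; rewrite !mxE opprK.
have vl : lsubmx v *m K x = a *: lsubmx v.
  have := congr1 lsubmx vJ; rewrite -mulmx_lsub J_l -{1}(hsubmxK v) mul_row_col.
  by rewrite mulmx0 addr0 => ->; apply/rowP => k; rewrite !mxE.
have [l0|l0] := eqVneq (lsubmx v) 0; last by apply/eigenvalueP; exists (lsubmx v).
have r0 : rsubmx v != 0.
  by apply: contra v0 => /eqP r0; rewrite -(hsubmxK v) l0 r0 row_mx0.
have vr : rsubmx v *m (K x)^T = a *: rsubmx v.
  have := congr1 rsubmx vJ; rewrite -mulmx_rsub -{1}(hsubmxK v) l0.
  rewrite -{1}(vsubmxK (rsubmx Jx)) mul_row_col mul0mx add0r -J_dr => ->.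
  by apply/rowP => k; rewrite !mxE.
have : eigenvalue (K x)^T a by apply/eigenvalueP; exists (rsubmx v).
rewrite /eigenvalue /eigenspace !kermx_eq0 !row_free_unit.
by rewrite -[X in (K x)^T - X]tr_scalar_mx -linearB unitmx_tr.
Qed.

Let sJ i j : smooth_on (M0 V) (fun y => J y i j).
Proof.
have [[sJ _] _] := JW.
by apply: (smooth_entry oM); apply: smooth_subset sJ => z /MU.
Qed.

Definition row_field i (y : coords) : coords := delta_mx 0 (lshift n i) *m J y.

Let row_fieldE i y a : row_field i y 0 a = J y (lshift n i) a.
Proof. by rewrite /row_field -rowE mxE. Qed.

#[local] Opaque row_field.

Let derive_row_field i v z a : M0 V z ->
  ('D_v (row_field i) z) 0 a = 'D_v (fun y => J y (lshift n i) a) z.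
Proof.
move=> Vz; rewrite derive_mx ?mxE; last first.
  apply/derivable_mxP => k l; rewrite (ord1 k).
  rewrite (_ : (fun y => row_field i y 0 l) = (fun y => J y (lshift n i) l)).
    by apply: diff_derivable; apply: smooth_differentiable (sJ _ _) Vz.
  by apply/funext => y; exact: row_fieldE.
by congr ('D_v _ z); apply/funext => y; exact: row_fieldE.
Qed.

Let derive_row_field_x i v x b : V x ->
  ('D_v (row_field i) (row_mx x 0)) 0 (lshift n b) =
  \sum_c v 0 (lshift n c) * partial c (fun y => K y i b) x.
Proof.
move=> Vx; rewrite (derive_row_field _ _ _ (V0 Vx)).
transitivity ('D_v (w (lshift n i) (rshift n b)) (row_mx x 0)).
  by apply: near_eq_derive; apply: (near_eq_on oM (V0 Vx)) => y Vy; exact: JE.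
rewrite derive_partial; last exact: smooth_differentiable (sw _ _) (V0 Vx).
rewrite big_split_ord /= [X in _ + X]big1 ?addr0 => [|c _]; last first.
  by rewrite (x_theta_invariant _ _ _ (V0 Vx)) scaler0.
by apply: eq_bigr => c _; rewrite partial_mixed_block.
Qed.

Let mulmx_J_x (v : coords) b x : V x -> (v *m J (row_mx x 0)) 0 (lshift n b) =
  \sum_c v 0 (lshift n c) * K x c b.
Proof.
move=> Vx; rewrite mxE big_split_ord /= [X in _ + X]big1 ?addr0 => [|c _].
  by apply: eq_bigr => c _; rewrite (JE _ _ (V0 Vx)) mixed_blockE.
by rewrite (JE _ _ (V0 Vx)) (theta_theta_eq0 _ _ (V0 Vx)) mulr0.
Qed.

(** The dx component of the torsion on the constant fields d/dx_i and
d/dx_j; the terms where J acts on a bracket cancel by [mixed_block_closed]. *)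
Lemma mixed_block_torsion i j b x : V x ->
  \sum_c K x i c * partial c (fun y => K y j b) x =
  \sum_c K x j c * partial i (fun y => K y c b) x.
Proof.
move=> Vx; pose z : coords := row_mx x 0.
pose ei : coords := delta_mx 0 (lshift n i); pose ej : coords := delta_mx 0 (lshift n j).
have := torsionJ (const_field ei) (const_field ej) (MU (V0 Vx)).
have D0 (v u : coords) : 'D_v (fun _ : coords => u) (row_mx x 0) = 0 by exact: derive_cst.
rewrite /lie_bracket.
have Ei : apply_tensor J (fun=> ei) = row_field i by [].
have Ej : apply_tensor J (fun=> ej) = row_field j by [].
rewrite Ei Ej /apply_tensor (D0 ei ej) (D0 ej ei) (D0 _ ej) (D0 _ ei) => T.
have := torsion_entry T (derive_row_field_x j _ b Vx)
  (derive_row_field_x i _ b Vx) (mulmx_J_x _ b Vx) (mulmx_J_x _ b Vx).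
have fE k c : row_field k (row_mx x 0) 0 (lshift n c) = K x k c.
  by rewrite row_fieldE (JE _ _ (V0 Vx)) mixed_blockE.
have dE k l c : ('D_(delta_mx 0 (lshift n k)) (row_field l) (row_mx x 0)) 0 (lshift n c) =
    partial k (fun y => K y l c) x.
  rewrite (derive_row_field_x _ _ _ Vx) (bigD1 k) //= big1 ?addr0.
    by rewrite mxE !eqxx mul1r.
  by move=> d /negPf dk; rewrite mxE eqxx eq_lshift dk mul0r.
have -> : \sum_c ('D_ej (row_field i) (row_mx x 0)) 0 (lshift n c) * K x c b =
          \sum_c ('D_ei (row_field j) (row_mx x 0)) 0 (lshift n c) * K x c b.
  by apply: eq_bigr => c _; rewrite !dE mixed_block_closed.
rewrite addrK => /eqP; rewrite subr_eq0 => /eqP.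
under eq_bigr do rewrite fE.
under [in X in _ = X -> _]eq_bigr do rewrite fE.
by move=> ->; apply: eq_bigr => c _; rewrite (mixed_block_closed c b i Vx).
Qed.

Definition solution_field (x : X) : 'M[R]_(n, n + 1) :=
  row_mx (K x) (\col_k partial k H x).

Lemma solution_field_op x : lsubmx (solution_field x) = K x.
Proof. exact: row_mxKl. Qed.

Lemma smooth_solution_field a b : smooth_on V (fun x => solution_field x a b).
Proof.
rewrite -(fintype.splitK b); case: (fintype.split b) => c /=.
  by apply: (smooth_ext oV) (smooth_mixed_block a c) => x _; rewrite row_mxEl.
apply: (smooth_ext oV) (smooth_partial a sH) => x _.
by rewrite row_mxEr mxE.
Qed.

(** The columns of K satisfy the system by the torsion identity, and the
gradient of H satisfies it because K times the Hessian is symmetric. *)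
Lemma solution_field_eq x u a b : V x ->
  'D_(u *m K x) (fun y => solution_field y a b) x =
  \sum_c K x a c * 'D_u (fun y => solution_field y c b) x.
Proof.
move=> Vx.
have df c : differentiable (fun y => solution_field y c b) x.
  by apply: smooth_differentiable (smooth_solution_field _ _) Vx.
have basic i : \sum_d K x i d * partial d (fun y => solution_field y a b) x =
    \sum_c K x a c * partial i (fun y => solution_field y c b) x.
  rewrite -(fintype.splitK b); case: (fintype.split b) => e /=.
    have E c : (fun y => solution_field y c (lshift 1 e)) = (fun y => K y c e).
      by apply/funext => y; rewrite row_mxEl.
    rewrite E; under [RHS]eq_bigr do rewrite E.
    exact: mixed_block_torsion.
  have E c : (fun y => solution_field y c (rshift n e)) = partial c H.
    by apply/funext => y; rewrite row_mxEr mxE.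
  rewrite E; under [RHS]eq_bigr do rewrite E.
  exact: mixed_block_hessian.
rewrite derive_partial //.
under eq_bigr do rewrite mxE [_ *: _]mulr_suml.
under [RHS]eq_bigr do rewrite derive_partial // mulr_sumr.
rewrite exchange_big /= [RHS]exchange_big /=; apply: eq_bigr => i _.
transitivity (u 0 i * \sum_d K x i d * partial d (fun y => solution_field y a b) x).
  by rewrite mulr_sumr; apply: eq_bigr => d _; rewrite mulrA.
rewrite basic mulr_sumr; apply: eq_bigr => c _.
by rewrite [_ *: _]/(_ * _) mulrCA.
Qed.

End BiHamiltonian.

(** * From a bi-Hamiltonian structure to a cyclic solution *)

Section Existence.
Variables (R : realType) (n : nat) (U : set 'rV[R]_n).
Hypothesis oU : open U.
Local Notation X := 'rV[R]_n.

Lemma open_nonzero (V : set X) (f : X -> R) : open V -> smooth_on V f ->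
  open [set x | V x /\ f x != 0].
Proof.
move=> oV sf; rewrite openE => x [Vx fx]; rewrite /interior /=.
have cf : {for x, continuous f}.
  by apply: differentiable_continuous; apply: smooth_differentiable sf Vx.
have nf : nbhs x [set y | f y != 0] := cvgr_neq0 (f x) cf fx.
exact: filterI (open_nbhs_nbhs (conj oV Vx)) (nf _).
Qed.

Lemma enumerate_card (A : set R) : (A #= `I_n)%card ->
  exists2 l : 'I_n -> R, injective l & forall i, A (l i).
Proof.
move=> /card_set_bijP[f [fA finj fsurj]].
have /choice[l lP] : forall i : 'I_n, exists a, A a /\ f a = i.
  by move=> i; have [a Aa <-] := fsurj i (ltn_ord i); exists a.
exists l; last by move=> i; case: (lP i).
by move=> i j ij; apply: val_inj; rewrite /= -(lP i).2 -(lP j).2 ij.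
Qed.

Variable H : X -> R.
Hypothesis sH : smooth_on U H.
Hypothesis U0 : U 0.

Lemma smooth_hessian_det : smooth_on U (fun x => \det (hessian H x)).
Proof.
apply: (smooth_det oU) => i j.
apply: (smooth_ext oU) (smooth_partial i (smooth_partial j sH)) => x _.
by rewrite mxE.
Qed.

Lemma bihamiltonian_solution : \det (hessian H 0) != 0 -> admits_bihamiltonian U H ->
  exists s : solution R n,
    dom s `<=` U /\ forall x a, fld s x a (rshift n ord0) = partial a H x.
Proof.
move=> H0 [W [J [XH [W_symp [JW torsionJ] hamX closedX eigJ]]]].
pose V := [set x | U x /\ \det (hessian H x) != 0].
have VU : V `<=` U by move=> x [].
have oV : open V by apply: open_nonzero => //; exact: smooth_hessian_det.
have ndeg x : V x -> hessian H x \in unitmx by case=> _; rewrite unitmxE unitfE.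
have sHV : smooth_on V H := smooth_subset VU sH.
have V0 : V 0 by split.
have Uz : M0 U (row_mx 0 0) by rewrite /M0 /= row_mxKl.
have [l linj lJ] := enumerate_card (eigJ _ Uz).
have lK i : eigenvalue (mixed_block W 0) (l i).
  exact: (eigenvalue_mixed_block oV VU sHV ndeg W_symp hamX closedX JW V0 (lJ i)).
have [v v_cyclic] := distinct_eigenvalues_cyclic linj lK.
pose D := [set x | V x /\ \det (krylov v (mixed_block W x)) != 0].
have sk : smooth_on V (fun x => \det (krylov v (mixed_block W x))).
  apply: (smooth_det oV); apply: (smooth_krylov oV) => i j.
  exact: (smooth_mixed_block oV VU W_symp).
have oD : open D by exact: open_nonzero.
have DV : D `<=` V by move=> x [].
have D0 : D 0 by split.
have D_smooth a b : smooth_on D (fun x => solution_field H W x a b).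
  apply: smooth_subset DV _; exact: (smooth_solution_field oV VU sHV W_symp).
have D_cyclic x : D x -> \det (krylov v (lsubmx (solution_field H W x))) != 0.
  by case=> _; rewrite solution_field_op.
have D_eq x u a b : D x ->
    'D_(u *m lsubmx (solution_field H W x)) (fun y => solution_field H W y a b) x =
    \sum_c lsubmx (solution_field H W x) a c * 'D_u (fun y => solution_field H W y c b) x.
  move=> /DV Vx; rewrite solution_field_op.
  exact: (solution_field_eq oV VU sHV ndeg W_symp hamX closedX JW torsionJ).
exists (Solution oD D0 D_smooth D_cyclic D_eq); split; first by move=> x /DV /VU.
by move=> x a; rewrite /= row_mxEr mxE.
Qed.

End Existence.

(** * Meagreness *)

Section Meagre.
Variables (R : realType) (n : nat) (U : set 'rV[R]_n).
Hypothesis oU : open U.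
Hypothesis U0 : U 0.
Local Notation X := 'rV[R]_n.
Local Notation C := (Cinfty U).

Let compact0 : compact [set 0 : X]. Proof. exact: compact_set1. Qed.
Let sub0 : [set 0 : X] `<=` U. Proof. by move=> _ ->. Qed.

Lemma continuous_partials0 (s : seq 'I_n) : continuous (fun H : C => partials s H 0).
Proof.
move=> H; apply/(@cvgrPdist_lt _ _ _ (nbhs H) (nbhs_filter H)) => e e0.
apply: (@filterS _ (nbhs H) (nbhs_filter H) _ _ _ (nbhs_jet H s sub0 compact0 e0)).
by move=> H'; apply.
Qed.

Lemma continuous_hessian_det : continuous (fun H : C => \det (hessian H 0)).
Proof.
have c i j : continuous (fun H : C => hessian H 0 i j).
  have -> : (fun H : C => hessian H 0 i j) = (fun H : C => partials [:: i; j] H 0).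
    by apply/funext => H; rewrite mxE.
  exact: continuous_partials0.
pose P (f : unit -> C -> R) := continuous (f tt).
have Pcst a : P (fun _ _ => a) by exact: cst_continuous.
have Padd f g : P f -> P g -> P (fun s x => f s x + g s x).
  by move=> cf cg H; exact: (continuousD (cf H) (cg H)).
have Pmul f g : P f -> P g -> P (fun s x => f s x * g s x).
  by move=> cf cg H; exact: (continuousM (cf H) (cg H)).
have Pext f g : P f -> (forall s x, True -> f s x = g s x) -> P g.
  move=> cf fg; rewrite /P (_ : g tt = f tt) //.
  by apply/funext => H; rewrite fg.
exact: (closed_det (D := fun _ _ => True) Pcst Padd Pmul Pext
  (A := fun _ (H : C) => hessian H 0)).
Qed.

Lemma closed_degenerate : closed [set H : C | \det (hessian H 0) = 0].
Proof.
apply: (@closed_comp _ _ (fun H : C => \det (hessian H 0)) [set 0]).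
  by move=> H _; exact: continuous_hessian_det.
exact: closed_eq.
Qed.

(** The bad shifts are roots of a characteristic polynomial, hence finite
in number. *)
Lemma small_nonsingular_shift (A : 'M[R]_n) (e : R) : 0 < e ->
  exists2 c, 0 < c <= e & \det (A + c%:M) != 0.
Proof.
move=> e0; pose p := char_poly (- A).
(* more candidates in ]0, e] than p can have roots *)
pose rs := [seq e / i.+1%:R | i <- iota 0 (size p)].
have p0 : p != 0 by rewrite monic_neq0 // char_poly_monic.
have urs : uniq rs.
  rewrite map_inj_uniq ?iota_uniq // => i j /(mulfI (lt0r_neq0 e0)) /invr_inj /eqP.
  by rewrite eqr_nat => /eqP [].
have /allPn[c crs ncp] : ~~ all (root p) rs.
  by apply/negP => /(max_poly_roots p0)/(_ urs); rewrite size_map size_iota ltnn.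
have /mapP[i _ ci] := crs.
exists c.
  rewrite ci divr_gt0 ?ltr0n //= ler_pdivrMr ?ltr0n // ler_peMr ?(ltW e0) //.
  by rewrite ler1n.
move: ncp; rewrite -eigenvalue_root_char /eigenvalue /eigenspace kermx_eq0 row_free_unit negbK.
rewrite unitmxE unitfE -opprD -scaleN1r detZ mulf_eq0 negb_or => /andP[_].
by [].
Qed.

(** Adding a small multiple of sum_i x_i^2 / 2 to H shifts its Hessian at 0
by a scalar matrix. *)
Lemma degenerate_interior : [set H : C | \det (hessian H 0) = 0]^° = set0.
Proof.
apply/seteqP; split => // H; rewrite /interior => nH.
have sq i : smooth_on U (divided_power i 2 : X -> R) by exact: smooth_divided_power.
have [P [PE Pnear]] := perturbation oU sq H.
have [e e0 Pe] := Pnear _ nH.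
have [c /andP[c0 ce] /negP] := small_nonsingular_shift (hessian H 0) e0; apply.
have small (i : 'I_n) : `|c| <= e by rewrite gtr0_norm.
have := Pe (fun=> c) small; rewrite /= => <-; apply/eqP; congr (\det _).
apply/matrixP => i j; rewrite [LHS]mxE [RHS]mxE [hessian H 0 i j]mxE [c%:M i j]mxE.
have := PE (fun=> c) [:: i; j] 0 U0; rewrite /= => ->; congr (_ + _).
rewrite (bigD1 i) //= big1 ?addr0 => [|k ki]; rewrite hessian_divided_square.
  by rewrite eqxx /= mulr_natr.
by rewrite (negPf ki) mulr0.
Qed.

Section JetImage.
Variables (i1 i2 : 'I_n).
Hypothesis i12 : i1 != i2.
Variable k : nat.
Definition jet_index : finType := ('I_k * 'I_k)%type.

Definition jet_seq (ij : jet_index) : seq 'I_n := nseq ij.1 i1 ++ nseq ij.2 i2.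

(** Applied to the partial derivative of H along i1, since a solution
contains the gradient of H and not H itself. *)
Definition gradient_jet (ij : jet_index) (f : X -> R) : R :=
  partials (jet_seq ij) (partial i1 f) 0.

Definition solution_jet (ij : jet_index) (s : solution R n) : R :=
  partials (jet_seq ij) (fun y => fld s y i1 (rshift n ord0)) 0.

Definition bounded_solution (N : R) (s : solution R n) : Prop :=
  forall p : parameter n k.*2, `|par p s| <= N.

(** The H whose jet lies in the closure of the jets of the solutions with
parameters bounded by N; taking the closure makes this set closed. *)
Definition near_solution_jets (N : R) : set C :=
  [set H | forall e, 0 < e -> exists2 s, bounded_solution N s &
    forall ij, `|solution_jet ij s - gradient_jet ij H| <= e].

Lemma jet_poly_solution_jet ij :
  jet_poly k.*2 (fun (s : solution R n) x => partials (jet_seq ij) (fun y => fld s y i1 (rshift n ord0)) x).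
Proof.
apply: (jet_poly_mono _ (jet_poly_partials R (jet_seq ij) i1 (rshift n ord0))).
by rewrite size_cat !size_nseq -addnn leq_add // ltnW.
Qed.

Lemma gradient_jetE ij f : gradient_jet ij f = partials (rcons (jet_seq ij) i1) f 0.
Proof. by rewrite partials_rcons. Qed.

Lemma closed_near_solution_jets N : closed (near_solution_jets N).
Proof.
move=> H clH e e0.
have e2 : 0 < e / 2 by rewrite divr_gt0.
have nH : nbhs H [set H' : C | forall ij, `|gradient_jet ij H - gradient_jet ij H'| < e / 2].
  apply: (@filter_forall _ _ (fun ij (H' : C) => `|gradient_jet ij H - gradient_jet ij H'| < e / 2)
    (nbhs H) (nbhs_filter H)) => ij.
  apply: (@filterS _ (nbhs H) (nbhs_filter H) _ _ _
    (nbhs_jet H (rcons (jet_seq ij) i1) sub0 compact0 e2)).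
  by move=> H' /(_ 0 erefl); rewrite !gradient_jetE.
have [H' [nearH' HH']] := clH _ nH.
have [s sN sH'] := nearH' _ e2; exists s => // ij.
have := ler_distD (gradient_jet ij H') (solution_jet ij s) (gradient_jet ij H).
move=> /le_trans; apply; rewrite [leRHS](splitr e); apply: lerD; first exact: sH'.
by rewrite distrC ltW //; exact: HH'.
Qed.

(** Monomials move the k^2 derivatives of H independently, so an interior
point would give a cube of jets in the closure of a Lipschitz image of a box of
smaller dimension. *)
Lemma near_solution_jets_interior N :
  (n + ((k.*2).+1 * (n * (n + 1))).+1 < k * k)%N -> (near_solution_jets N)^° = set0.
Proof.
move=> few; apply/seteqP; split => // H; rewrite /interior => nH.
have sq (ij : jet_index) : smooth_on U (monomial i1 i2 ij.1.+1 ij.2 : X -> R).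
  exact: smooth_monomial.
have [P [PE Pnear]] := perturbation oU sq H.
have [e e0 Pe] := Pnear _ nH.
have jetP c ij : gradient_jet ij (P c) = gradient_jet ij H + c ij.
  rewrite !gradient_jetE PE //; congr (_ + _).
  rewrite (bigD1 ij) //= big1 ?addr0 => [|kl klij]; rewrite partials_rcons mixed_jet_monomial //.
    by rewrite !eqxx mulr1.
  case: kl ij klij => [k1 l1] [k2 l2] ne /=; case: eqP => [/val_inj E1|]; last by rewrite mulr0.
  case: eqP => [/val_inj E2|]; last by rewrite mulr0.
  by rewrite E1 E2 eqxx in ne.
pose T := {s : solution R n | bounded_solution N s}.
pose a (s : T) (p : parameter n k.*2) := par p (sval s).
pose j (s : T) (ij : jet_index) := solution_jet ij (sval s).
have /choice[L LP] : forall ij, exists L, 0 <= L /\ forall (s t : T) d,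
    (forall p, `|a s p - a t p| <= d) -> `|j s ij - j t ij| <= L * d.
  move=> ij; have [L L0 LP] := jet_poly_lipschitz N (jet_poly_solution_jet ij).
  exists L; split => // s t d st.
  by have [] := LP (sval s) (sval t) d (svalP s) (svalP t) st.
have L0 : 0 <= \sum_ij L ij by apply: sumr_ge0 => ij _; case: (LP ij).
have jL (s t : T) d : (forall p, `|a s p - a t p| <= d) ->
    forall ij, `|j s ij - j t ij| <= (\sum_ij L ij) * d.
  move=> st ij; apply: (le_trans ((LP ij).2 s t d st)); apply: ler_wpM2r.
    exact: le_trans (st (inr None)).
  rewrite (bigD1 ij) //= lerDl; apply: sumr_ge0 => kl _; by case: (LP kl).
have card_lt : (#|{: parameter n k.*2}| < #|{: jet_index}|)%N.
  by rewrite card_parameter card_prod !card_ord.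
have [t tH [eps eps0 far]] := lipschitz_image_nowhere_dense card_lt L0
  (fun s : T => svalP s) jL (fun ij => gradient_jet ij H) e0.
have [s sN close] := Pe (fun ij => t ij - gradient_jet ij H) tH eps eps0.
have [ij] := far (exist _ s sN); rewrite ltNge => /negP; apply.
by have := close ij; rewrite jetP addrCA subrr addr0.
Qed.

Lemma solution_near_jets (s : solution R n) (H : C) : dom s `<=` U ->
  (forall x a, fld s x a (rshift n ord0) = partial a H x) ->
  exists N : nat, near_solution_jets N%:R H.
Proof.
move=> sU sH; exists (Num.truncn (\sum_p `|par (M := k.*2) p s|)).+1 => e e0.
exists s.
  move=> p; apply: (@le_trans _ _ (\sum_p `|par (M := k.*2) p s|)).
    by rewrite (bigD1 p) //= lerDl sumr_ge0.
  by rewrite ltW // truncnS_gt.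
move=> ij; rewrite /solution_jet /gradient_jet.
have -> : (fun y => fld s y i1 (rshift n ord0)) = partial i1 H by apply/funext => y.
by rewrite subrr normr0 ltW.
Qed.
End JetImage.

Lemma enough_jets : exists k, (n + ((k.*2).+1 * (n * (n + 1))).+1 < k * k)%N.
Proof.
(* with m = n (n + 1) there are 2 k m + n + m + 1 parameters, so k = 2 m + r
   works once k r exceeds n + m + 1 *)
exists (2 * (n * (n + 1)) + (n * (n + 1) + n + 2))%N.
by move: (n * (n + 1))%N => m; rewrite -muln2; nia.
Qed.

Theorem meagre_bihamiltonian : (2 <= n)%N ->
  meagre [set H : C | admits_bihamiltonian U H].
Proof.
move=> n2; have [k few] := enough_jets.
pose i1 : 'I_n := Ordinal (ltnW n2); pose i2 : 'I_n := Ordinal n2.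
have i12 : i1 != i2 by [].
exists (fun m => if m is N.+1 then near_solution_jets i1 i2 k N%:R
                else [set H : C | \det (hessian H 0) = 0]); split.
  case=> [|N]; split.
  - exact: closed_degenerate.
  - exact: degenerate_interior.
  - exact: closed_near_solution_jets.
  - exact: near_solution_jets_interior.
move=> H /= bH; have [H0|H0] := eqVneq (\det (hessian H 0)) 0.
  by exists 0%N.
have [s [sU sH]] := bihamiltonian_solution oU (@cfun_smooth _ _ _ H) U0 H0 bH.
have [N HN] := solution_near_jets i1 i2 k sU sH.
by exists N.+1.
Qed.

End Meagre.

Lemma open_euclidean_unit_ball (R : realType) (n : nat) : open (euclidean_unit_ball R n).
Proof.
have sf : smooth_on setT (fun x : 'rV[R]_n => \sum_(i < n) x 0 i ^+ 2).
  apply: (smooth_sum openT) => i.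
  apply: (smooth_ext openT) (smooth_mul openT (smooth_coord openT i) (smooth_coord openT i)).
  by move=> x _; rewrite expr2.
apply: (@open_comp _ _ (fun x : 'rV[R]_n => \sum_(i < n) x 0 i ^+ 2) [set t | t < 1]).
  by move=> x _; apply: differentiable_continuous; apply: smooth_differentiable sf _.
exact: open_lt.
Qed.

Theorem theorem3p7 (R : realType) (n : nat) (hn : (2 <= n)%N) :
  meagre [set H : Cinfty (euclidean_unit_ball R n)
         | admits_bihamiltonian (euclidean_unit_ball R n) H].
Proof.
apply: meagre_bihamiltonian hn; first exact: open_euclidean_unit_ball.
by rewrite /euclidean_unit_ball /= big1 ?ltr01 // => i _; rewrite mxE expr0n.
Qed.
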